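(* Let the array $\mathcal A$ be a disk of radius $a$, and let $N$ dipoles be aligned in the range direction of $\mathcal A$: $\vec y_j=(y_*,L+\eta_j)$ with polarization vectors $\vec p_j=(p_j,p_{j,z})\in\mathbb C^3$, $p_j\in\mathbb C^2$, $\|\vec p_j\|=\mathcal O(1)$, $j=1,\dots,N$. Assume the Fraunhofer regime holds uniformly over the frequency band $[\omega_0-B/2,\omega_0+B/2]$. Let $p\in\mathbb C^2$ (depending on the imaging point $\vec y$) be the cross-range polarization image, i.e. the solution of the linear system $$\Big[\int_{|\omega-\omega_0|<B/2}\mathbb H_{1:2,1:2}\Big(\vec y,\vec y;\frac{\omega}{c}\Big)\,\mathrm d\omega\Big]\,p=\mathcal I_{\mathrm{KM}}(\vec y).$$ Then: (i) If the imaging point is a dipole location, $\vec y=\vec y_i$, then $$\|p-p_i\|=\mathcal O\Big(\frac{c}{B\,\min_{j\ne i}|\eta_i-\eta_j|}\Big)+o(1).$$ (ii) If the imaging point range is different from any of the dipole ranges, i.e. $\vec y=(y_*,L+\eta)\ne\vec y_j$ for all $j=1,\dots,N$, then $$\|p\|=\mathcal O\Big(\frac{c}{B\,\min_{j=1,\dots,N}|\eta-\eta_j|}\Big)+o(1).$$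
   Context: Notation. Points of $\mathbb R^3$ are written $\vec x=(x,z)$ with $x\in\mathbb R^2$ the cross-range part and $z$ the range part. $c>0$ is the wave speed, $\mu>0$ the magnetic permeability, $\omega>0$ the angular frequency, $k=\omega/c$. With $\vec r=\vec x-\vec y$, $r=\|\vec r\|$, $m(kr)=(\mathrm i kr-1)/(kr)^2$, and $G(\vec x,\vec y;k)=\frac{e^{\mathrm i k\|\vec x-\vec y\|}}{4\pi\|\vec x-\vec y\|}$, the dyadic Green function is the $3\times3$ matrix $$\mathbb G(\vec x,\vec y;k)=G(\vec x,\vec y;k)\Big[(1+m(kr))\mathbb I-(1+3m(kr))\frac{\vec r\,\vec r^{\top}}{r^2}\Big].$$ Array, data, image. $\mathcal A=\{x_r\in\mathbb R^2:\|x_r\|\le a\}$, receivers are $\vec x_r=(x_r,0)$, $x_r\in\mathcal A$. The data are $\vec\Pi(x_r;k)=\mu\omega^2\sum_{j=1}^N\mathbb G(\vec x_r,\vec y_j;k)\vec p_j$. Put $$\mathbb H(\vec y,\vec y';k)=\int_{\mathcal A}\overline{\mathbb G(\vec x_r,\vec y;k)}\,\mathbb G(\vec x_r,\vec y';k)\,\mathrm dx_r,\qquad \vec{\mathcal I}_{\mathrm{KM}}(\vec y;k)=(\mu\omega^2)^{-1}\int_{\mathcal A}\overline{\mathbb G(\vec x_r,\vec y;k)}\,\vec\Pi(x_r;k)\,\mathrm dx_r=\sum_{j=1}^N\mathbb H(\vec y,\vec y_j;k)\vec p_j .$$ $\mathcal I_{\mathrm{KM}}(\vec y)\in\mathbb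 C^2$ denotes the first two components of the band-integrated imaging function $\vec{\mathcal I}_{\mathrm{KM}}(\vec y)=\int_{|\omega-\omega_0|<B/2}\vec{\mathcal I}_{\mathrm{KM}}(\vec y;\omega/c)\,\mathrm d\omega$, and $\mathbb H_{1:2,1:2}$ is the leading $2\times2$ principal submatrix of $\mathbb H$. The $2\times2$ system is considered sufficiently far into the Fraunhofer regime, where it is uniquely solvable. Fraunhofer regime. Imaging points and dipole positions lie in the imaging window: they are of the form $(y,L+\eta)$ with $\|y\|=\mathcal O(b)$ and $|\eta|=\mathcal O(h)$. Put $\Theta_a=ka^2/L$, $\Theta_b=kb^2/L$, $\Theta_h=kh^2/L$. The parameters vary so that $kL\gg1$, $a\ll L$, $b\ll L$, $h\ll L$, $\Theta_b\ll1$, $1\ll\Theta_a\ll L^2/a^2$ and $kh=\mathcal O(1)$, where $X\ll Y$ means $X/Y\to0$, all of this uniformly for $k=\omega/c$ with $\omega\in[\omega_0-B/2,\omega_0+B/2]$; $N$ is fixed and the $\eta_j$ are distinct. The symbols $\mathcal O$, $o$ refer to this limit, uniformly over points of the imaging window. The term with $\min_{j\ne i}$ is absent if $N=1$. *)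

(* Defs.v *)
From HB Require Import structures.
From mathcomp Require Import all_boot all_order all_algebra.
From mathcomp Require Import all_classical all_reals all_analysis.
From mathcomp Require Import complex.

Set Implicit Arguments.
Unset Strict Implicit.
Unset Printing Implicit Defensive.

Import Order.TTheory GRing.Theory Num.Theory.
Import numFieldNormedType.Exports.

Local Open Scope classical_set_scope.
Local Open Scope ring_scope.
Local Open Scope complex_scope.

(* The library has no integral of complex-valued functions: integrate the real
   and imaginary parts, and integrate matrices entrywise. *)
Definition cintegral (R : realType) (d : measure_display)
    (T : measurableType d) (nu : {measure set T -> \bar R})
    (D : set T) (f : T -> R[i]) : R[i] :=
  Rintegral nu D (fun x => complex.Re (f x)) +i*
  Rintegral nu D (fun x => complex.Im (f x)).

Definition mxintegral (R : realType) (d : measure_display)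
    (T : measurableType d) (nu : {measure set T -> \bar R})
    (m n : nat) (D : set T) (f : T -> 'M[R[i]]_(m, n)) : 'M[R[i]]_(m, n) :=
  \matrix_(i, j) cintegral nu D (fun x => f x i j).

(* Euclidean norms; the library norms on products and matrices are sup norms. *)
Definition norm2 (R : realType) (x : R * R) : R :=
  Num.sqrt (x.1 ^+ 2 + x.2 ^+ 2).

Definition enorm (R : realType) (n : nat) (v : 'cV[R]_n) : R :=
  Num.sqrt (\sum_i v i 0 ^+ 2).

Definition cnorm (R : realType) (n : nat) (v : 'cV[R[i]]_n) : R :=
  Num.sqrt (\sum_i Normc.normc (v i 0) ^+ 2).

(* The minimum of a nonempty list (0 for the empty list). *)
Definition seqmin (R : realType) (s : seq R) : R :=
  \big[Num.min/head 0 s]_(x <- s) x.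

Section DyadicGreen.
Variable R : realType.

(* The point (x, z), with cross-range part x and range part z. *)
Definition point3 (x : R * R) (z : R) : 'cV[R]_3 :=
  \col_(i < 3) [:: x.1; x.2; z]`_i.

Definition green (x y : 'cV[R]_3) (k : R) : R[i] :=
  let r := enorm (x - y) in
  (cos (k * r) +i* sin (k * r)) / (4 * pi * r)%:C.

Definition mcoef (t : R) : R[i] := ('i * t%:C - 1) / (t ^+ 2)%:C.

Definition dyadic_green (x y : 'cV[R]_3) (k : R) : 'M[R[i]]_3 :=
  let v := x - y in
  let r := enorm v in
  green x y k *:
    ((1 + mcoef (k * r))%:M
     - (1 + 3%:R * mcoef (k * r)) *:
         map_mx (fun t : R => t%:C) ((r ^- 2) *: (v *m v^T))).

Definition conj_mx (m n : nat) (A : 'M[R[i]]_(m, n)) : 'M[R[i]]_(m, n) :=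
  map_mx (fun z : R[i] => conjc z) A.

End DyadicGreen.

(* The varying parameters: wave speed, permeability, array radius, cross-range
   and range sizes of the imaging window, distance from the array to the
   window, central angular frequency and bandwidth. *)
Record params (R : realType) := Params {
  speed : R;
  perm : R;
  arad : R;
  bwin : R;
  hwin : R;
  dist : R;
  freq0 : R;
  bandw : R }.

Section Imaging.
Variable R : realType.
Variable P : params R.

Definition admissible : Prop :=
  [/\ 0 < speed P, 0 < perm P & 0 < arad P] /\
  [/\ 0 < bwin P, 0 < hwin P & 0 < dist P] /\
  (0 < bandw P /\ 0 < freq0 P - bandw P / 2).

Definition wavenum (w : R) : R := w / speed P.

Definition array : set (R * R) := [set x | norm2 x <= arad P].

Definition band : set R := [set w | `|w - freq0 P| < bandw P / 2].

Definition closed_band : set R :=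
  [set w | freq0 P - bandw P / 2 <= w <= freq0 P + bandw P / 2].

Definition array_integral (m n : nat) (f : R * R -> 'M[R[i]]_(m, n)) :
    'M[R[i]]_(m, n) :=
  mxintegral ((@lebesgue_measure R) \x (@lebesgue_measure R))%E array f.

Definition band_integral (m n : nat) (f : R -> 'M[R[i]]_(m, n)) :
    'M[R[i]]_(m, n) :=
  mxintegral (@lebesgue_measure R) band f.

Definition Hmx (y y' : 'cV[R]_3) (k : R) : 'M[R[i]]_3 :=
  array_integral (fun x =>
    conj_mx (dyadic_green (point3 x 0) y k) *m dyadic_green (point3 x 0) y' k).

Section Data.
Variables (N : nat) (yd : 'I_N -> 'cV[R]_3) (pd : 'I_N -> 'cV[R[i]]_3).

Definition data (x : R * R) (w : R) : 'cV[R[i]]_3 :=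
  (perm P * w ^+ 2)%:C *:
    \sum_(j < N) dyadic_green (point3 x 0) (yd j) (wavenum w) *m pd j.

Definition imageKM_at (y : 'cV[R]_3) (w : R) : 'cV[R[i]]_3 :=
  ((perm P * w ^+ 2)^-1)%:C *:
    array_integral (fun x =>
      conj_mx (dyadic_green (point3 x 0) y (wavenum w)) *m data x w).

(* The first two components of a vector in C^3. *)
Definition cross_range (v : 'cV[R[i]]_3) : 'cV[R[i]]_2 :=
  usubmx (v : 'cV[R[i]]_(2 + 1)).

Definition imageKM (y : 'cV[R]_3) : 'cV[R[i]]_2 :=
  cross_range (band_integral (imageKM_at y)).

Definition system_mx (y : 'cV[R]_3) : 'M[R[i]]_2 :=
  band_integral (fun w =>
    ulsubmx (Hmx y y (wavenum w) : 'M[R[i]]_(2 + 1, 2 + 1))).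

Definition polarization_system (y : 'cV[R]_3) (p : 'cV[R[i]]_2) : Prop :=
  system_mx y *m p = imageKM y.

End Data.
End Imaging.

Section FraunhoferRegime.
Variable R : realType.
Variable F : set_system (params R).

(* The limiting regime is a filter F on the parameters; X << Y means that
   X / Y tends to 0 along F, uniformly for frequencies in the closed band. *)
Definition much_less (X Y : params R -> R -> R) : Prop :=
  forall e : R, 0 < e ->
    \forall P \near F, forall w, closed_band P w -> `|X P w / Y P w| <= e.

Definition bounded_along (X : params R -> R -> R) : Prop :=
  exists M : R, \forall P \near F, forall w, closed_band P w -> `|X P w| <= M.

Definition Theta (len : params R -> R) (P : params R) (w : R) : R :=
  wavenum P w * len P ^+ 2 / dist P.

Record fraunhofer : Prop := Fraunhofer {
  fr_admissible : \forall P \near F, admissible P;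
  fr_kL : much_less (fun _ _ => 1) (fun P w => wavenum P w * dist P);
  fr_a : much_less (fun P _ => arad P) (fun P _ => dist P);
  fr_b : much_less (fun P _ => bwin P) (fun P _ => dist P);
  fr_h : much_less (fun P _ => hwin P) (fun P _ => dist P);
  fr_Theta_b : much_less (Theta (@bwin R)) (fun _ _ => 1);
  fr_Theta_a_large : much_less (fun _ _ => 1) (Theta (@arad R));
  fr_Theta_a_small :
    much_less (Theta (@arad R)) (fun P _ => dist P ^+ 2 / arad P ^+ 2);
  fr_kh : bounded_along (fun P w => wavenum P w * hwin P) }.

End FraunhoferRegime.

(* c / (B min_(j <> i) |eta_i - eta_j|), absent when there is one dipole. *)
Definition rate_at_dipole (R : realType) (P : params R) (N : nat)
    (eta : 'I_N -> R) (i : 'I_N) : R :=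
  if (N == 1)%N then 0 else
  speed P /
    (bandw P * seqmin [seq `|eta i - eta j| | j <- enum 'I_N & j != i]).

Definition rate_off_dipoles (R : realType) (P : params R) (N : nat)
    (eta : 'I_N -> R) (z : R) : R :=
  speed P / (bandw P * seqmin [seq `|z - eta j| | j <- enum 'I_N]).

(* Dipoles at (ys, L + eta_j) in the imaging window, with distinct ranges and
   bounded polarizations; Kb, Kh, Kp are the constants implicit in
   |ys| = O(b), |eta_j| = O(h) and |p_j| = O(1). *)
Definition aligned_dipoles (R : realType) (Kb Kh Kp : R) (P : params R)
    (N : nat) (ys : R * R) (eta : 'I_N -> R) (pd : 'I_N -> 'cV[R[i]]_3) :
    Prop :=
  [/\ norm2 ys <= Kb * bwin P,
      forall j, `|eta j| <= Kh * hwin P,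
      injective eta
    & forall j, cnorm (pd j) <= Kp].

(* Main.v *)
(* Put k = w / c and r, r' = |x - y|, |x - y'| for y = (ys, L + z) and
   y' = (ys, L + z').  In the Fraunhofer regime every relative error is O(e),
   where e is comparable to 1/(kL) + (a + b + h)/L:
   the matrix G(x, y) divided by the scalar Green function is diag(1, 1, 0) + O(e),
   because the unit vector from y to x is nearly the range direction and
   m(kr) = O(1/(kL)); moreover L^2 / (r r') = 1 + O(e), and since
   r' - r = (z' - z) (2L + z + z') / (r + r') and kh = O(1), the phase
   k (r' - r) is k (z' - z) + O(e).  Hence, uniformly on the array and the band,
     conj G(x, y) G(x, y') =
       (4 pi L)^-2 (e^(i k (z' - z)) diag(1, 1, 0) + O(e)).
   Integrating over the array and the band, the system matrix is
   beta (I + O(e)) with beta = |A| B / (4 pi L)^2, and the right-hand side is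
   (beta / B) sum_j p_j phi(eta_j - z) + beta O(e), where
   phi(t) = int_band e^(i w t / c) dw satisfies phi(0) = B and
   |phi(t)| <= 4 c / |t|. *)

Require Import Defs.
From HB Require Import structures.
From mathcomp Require Import all_boot all_order all_algebra.
From mathcomp Require Import all_classical all_reals all_analysis.
From mathcomp Require Import complex.
From mathcomp Require Import measurable_realfun ring lra.

Set Implicit Arguments.
Unset Strict Implicit.
Unset Printing Implicit Defensive.

Import Order.TTheory GRing.Theory Num.Theory.
Import numFieldNormedType.Exports.

Local Open Scope classical_set_scope.
Local Open Scope ring_scope.
Local Open Scope complex_scope.

Local Notation normc := Normc.normc.

(** * Moduli of complex numbers, unit phases and Euclidean norms *)

Section ComplexNorm.
Variable R : realType.
Implicit Types (x y z : R[i]) (a b t : R).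

Lemma normc_ge0 z : 0 <= normc z.
Proof. by case: z => a b; exact: sqrtr_ge0. Qed.

Lemma normc_sqr z : normc z ^+ 2 = complex.Re z ^+ 2 + complex.Im z ^+ 2.
Proof. by case: z => a b; rewrite sqr_sqrtr// addr_ge0// sqr_ge0. Qed.

Lemma normr_Re_le_normc z : `|complex.Re z| <= normc z.
Proof.
by rewrite -(ger0_norm (normc_ge0 z)) -ler_sqr ?nnegrE// !real_normK ?num_real//
  normc_sqr lerDl sqr_ge0.
Qed.

Lemma normr_Im_le_normc z : `|complex.Im z| <= normc z.
Proof.
by rewrite -(ger0_norm (normc_ge0 z)) -ler_sqr ?nnegrE// !real_normK ?num_real//
  normc_sqr lerDr sqr_ge0.
Qed.

Lemma normc_le_ReIm z : normc z <= `|complex.Re z| + `|complex.Im z|.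
Proof.
rewrite -ler_sqr ?nnegrE ?normc_ge0 ?addr_ge0// normc_sqr sqrrD.
rewrite !real_normK ?num_real//.
by rewrite -addrA addrCA lerDr mulrn_wge0// mulr_ge0.
Qed.

Lemma normc_conj z : normc z^*%C = normc z.
Proof. by case: z => a b /=; rewrite sqrrN. Qed.

Lemma conjcM x y : (x * y)^*%C = x^*%C * y^*%C.
Proof. exact: rmorphM. Qed.

Lemma normc_real a : normc a%:C = `|a|.
Proof. by rewrite /= expr0n addr0 sqrtr_sqr. Qed.

Lemma le_normcB x y : normc (x - y) <= normc x + normc y.
Proof. by rewrite -(normcN y) le_normcD. Qed.

Lemma le_normc_sum (I : Type) (r : seq I) (Q : pred I) (f : I -> R[i]) :
  normc (\sum_(i <- r | Q i) f i) <= \sum_(i <- r | Q i) normc (f i).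
Proof.
elim/big_ind2 : _ => //; first by rewrite Normc.normc0.
by move=> ? ? ? ? h1 h2; rewrite (le_trans (le_normcD _ _))// lerD.
Qed.

Lemma normc_le_dist x y : normc x <= normc y + normc (x - y).
Proof. by rewrite -[X in normc X <= _](subrKC y x) le_normcD. Qed.

(** Telescope as (x1 - y1) x2 + y1 (x2 - y2), then bound |x2| by |y2| + |x2 - y2|: only the sizes of
    the reference factors y1, y2 and of the two errors remain. *)
Lemma le_normc_mulB x1 x2 y1 y2 :
  normc (x1 * x2 - y1 * y2) <=
  normc (x1 - y1) * (normc y2 + normc (x2 - y2)) + normc y1 * normc (x2 - y2).
Proof.
have -> : x1 * x2 - y1 * y2 = (x1 - y1) * x2 + y1 * (x2 - y2) by ring.
rewrite (le_trans (le_normcD _ _))// !Normc.normcM lerD// ler_wpM2l ?normc_ge0//.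
exact: normc_le_dist.
Qed.

Definition expi t : R[i] := cos t +i* sin t.

Lemma normc_expi t : normc (expi t) = 1.
Proof. by rewrite /= cos2Dsin2 sqrtr1. Qed.

Lemma expi0 : expi 0 = 1.
Proof. by rewrite /expi cos0 sin0. Qed.

Lemma conj_expiM a b : (expi a)^*%C * expi b = expi (b - a).
Proof.
apply/eqP; rewrite eq_complex /= cosB sinB.
by apply/andP; split; apply/eqP; ring.
Qed.

Lemma cos_lipschitz a b : `|cos a - cos b| <= `|a - b|.
Proof.
wlog ab : a b / b <= a => [h|].
  by have [/h//|/ltW/h] := leP b a; rewrite distrC [leRHS]distrC.
have [|c _ ->] := @MVT_segment R cos (fun u => - sin u) b a ab _.
  by apply/continuous_subspaceT => ?; exact: continuous_cos.
by rewrite normrM normrN ler_piMl// sin_max.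
Qed.

Lemma sin_lipschitz a b : `|sin a - sin b| <= `|a - b|.
Proof.
wlog ab : a b / b <= a => [h|].
  by have [/h//|/ltW/h] := leP b a; rewrite distrC [leRHS]distrC.
have [|c _ ->] := @MVT_segment R sin cos b a ab _.
  by apply/continuous_subspaceT => ?; exact: continuous_sin.
by rewrite normrM ler_piMl// cos_max.
Qed.

(** The factor 2 comes from adding the Lipschitz bounds of the real and imaginary parts. *)
Lemma expi_lipschitz a b : normc (expi a - expi b) <= 2 * `|a - b|.
Proof.
rewrite (le_trans (normc_le_ReIm _))//= mulrDl mul1r.
by rewrite lerD// ?cos_lipschitz ?sin_lipschitz.
Qed.

Lemma cnorm_le_sum n (v : 'cV[R[i]]_n) : cnorm v <= \sum_i normc (v i 0).
Proof.
have s0 : 0 <= \sum_i normc (v i 0) by apply: sumr_ge0 => i _; exact: normc_ge0.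
rewrite -ler_sqr ?nnegrE ?sqrtr_ge0// sqr_sqrtr; last first.
  by apply: sumr_ge0 => i _; exact: sqr_ge0.
rewrite expr2 mulr_suml; apply: ler_sum => i _.
rewrite expr2 ler_wpM2l ?normc_ge0// (bigD1 i)//= lerDl.
by apply: sumr_ge0 => j _; exact: normc_ge0.
Qed.

Lemma normc_le_cnorm n (v : 'cV[R[i]]_n) i : normc (v i 0) <= cnorm v.
Proof.
rewrite -ler_sqr ?nnegrE ?sqrtr_ge0 ?normc_ge0// sqr_sqrtr; last first.
  by apply: sumr_ge0 => j _; exact: sqr_ge0.
by rewrite (bigD1 i)//= lerDl; apply: sumr_ge0 => j _; exact: sqr_ge0.
Qed.

End ComplexNorm.

(** * Perturbations of scalar 2 x 2 matrices *)

Section NearScalar.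
Variable R : realType.

(** With m the largest |q i|, isolating beta q i leaves two error terms, each at most (beta / 4) m.
    Hence beta m <= beta t + (beta / 2) m, and half of beta m is absorbed on the left. *)
Lemma near_scalar_bound (M : 'M[R[i]]_2) (beta t : R) (q : 'cV[R[i]]_2) :
  0 < beta ->
  (forall i j, normc (M i j - beta%:C * (i == j)%:R) <= beta / 4) ->
  (forall i, normc ((M *m q) i 0) <= beta * t) ->
  forall i, normc (q i 0) <= 2 * t.
Proof.
move=> b0 hM ht.
pose m := Num.max (normc (q 0 0)) (normc (q 1 0)).
have qm i : normc (q i 0) <= m.
  have [->|->] : i = 0 \/ i = 1.
    by case: i => -[|[|//]] ?; [left|right]; exact: val_inj.
  - by rewrite le_max lexx.
  - by rewrite le_max lexx orbT.
have key i : beta * normc (q i 0) <= beta * t + beta / 2 * m.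
  have -> : beta * normc (q i 0) = normc (beta%:C * q i 0).
    by rewrite Normc.normcM normc_real gtr0_norm.
  have -> : beta%:C * q i 0 =
      (M *m q) i 0 - \sum_j (M i j - beta%:C * (i == j)%:R) * q j 0.
    rewrite mxE -sumrB (eq_bigr (fun j => beta%:C * (i == j)%:R * q j 0));
      last first.
      by move=> j _; ring.
    rewrite (bigD1 i)//= eqxx mulr1 big1 ?addr0// => j ji.
    by rewrite eq_sym (negbTE ji) mulr0 mul0r.
  rewrite (le_trans (le_normcB _ _))// lerD//.
  rewrite (le_trans (le_normc_sum _ _ _))//.
  apply: (@le_trans _ _ (\sum_(j < 2) beta / 4 * m)).
    apply: ler_sum => j _; rewrite Normc.normcM ler_pM ?normc_ge0//; exact: hM.
  by rewrite sumr_const card_ord -mulr_natr; lra.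
have mle : m <= 2 * t.
  have : beta * m <= beta * t + beta / 2 * m.
    by rewrite {1}/m; case: (leP (normc (q 0 0)) (normc (q 1 0))) => _; exact: key.
  by move=> h; rewrite -(ler_pM2l b0); lra.
by move=> i; rewrite (le_trans (qm i)).
Qed.

(** The previous bound with t = 0 shows that M has trivial kernel. [kermx] is a left kernel, hence
    the passage through the transpose. *)
Lemma near_scalar_unit (M : 'M[R[i]]_2) (beta : R) : 0 < beta ->
  (forall i j, normc (M i j - beta%:C * (i == j)%:R) <= beta / 4) ->
  M \in unitmx.
Proof.
move=> b0 hM; rewrite -unitmx_tr -row_free_unit -kermx_eq0.
apply/eqP/row_matrixP => i; rewrite row0.
have := mulmx_ker M^T; move/(congr1 (row i)); rewrite row_mul row0.
set v := row i _ => /(congr1 trmx); rewrite trmx_mul trmxK trmx0 => Mv.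
have v0 := near_scalar_bound b0 hM (t := 0) (q := v^T).
apply/rowP => j; rewrite [RHS]mxE; apply: Normc.eq0_normc; apply/eqP.
rewrite eq_le normc_ge0 andbT -(mulr0 2) .
have -> : v 0 j = v^T j 0 by rewrite [RHS]mxE.
apply: v0 => k; by rewrite Mv mxE Normc.normc0 mulr0.
Qed.

End NearScalar.

(** * Measurability of complex-valued functions *)

Section ComplexMeasurable.
Variables (R : realType) (d : measure_display) (T : measurableType d).
Variable D : set T.

Definition cmeasurable (f : T -> R[i]) : Prop :=
  measurable_fun D (fun x => complex.Re (f x)) /\
  measurable_fun D (fun x => complex.Im (f x)).

(** Write 1/f as f times the power -1 of f^2, a measurable function of a nonnegative number. Where f
    vanishes both sides are 0, by the convention on the inverse of 0. *)
Lemma measurable_funV (f : T -> R) :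
  measurable_fun D f -> measurable_fun D (fun x => (f x)^-1).
Proof.
move=> mf.
have -> : (fun x => (f x)^-1) =
    (fun x => f x * (fun y => y `^ (-1)) (f x ^+ 2)).
  apply/funext => x; rewrite powR_inv1 ?sqr_ge0//.
  have [->|fx0] := eqVneq (f x) 0; first by rewrite invr0 mul0r.
  by rewrite expr2 invfM mulrA mulfV// mul1r.
apply: measurable_funM => //.
apply: (measurableT_comp (measurable_powR (-1))).
exact: measurable_funX.
Qed.

Lemma measurable_fun_sqrt (f : T -> R) :
  measurable_fun D f -> measurable_fun D (fun x => Num.sqrt (f x)).
Proof.
move=> mf; apply: (measurableT_comp _ mf).
apply: continuous_measurable_fun => x; exact: sqrt_continuous.
Qed.

Lemma cmeasurable_cst (c : R[i]) : cmeasurable (fun=> c).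
Proof. by split; exact: measurable_cst. Qed.

Lemma cmeasurable_real (f : T -> R) :
  measurable_fun D f -> cmeasurable (fun x => (f x)%:C).
Proof. by move=> mf; split => //=; exact: measurable_cst. Qed.

Lemma cmeasurable_expi (f : T -> R) :
  measurable_fun D f -> cmeasurable (fun x => expi (f x)).
Proof.
move=> mf; split => /=; apply: (measurableT_comp _ mf);
  apply: continuous_measurable_fun.
- exact: continuous_cos.
- exact: continuous_sin.
Qed.

Lemma cmeasurableD (f g : T -> R[i]) :
  cmeasurable f -> cmeasurable g -> cmeasurable (fun x => f x + g x).
Proof.
move=> [f1 f2] [g1 g2]; split.
- rewrite (_ : (fun _ => _) = (fun x => complex.Re (f x) + complex.Re (g x))).
    exact: measurable_funD.
  by apply/funext => x; case: (f x) (g x) => ? ? [].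
- rewrite (_ : (fun _ => _) = (fun x => complex.Im (f x) + complex.Im (g x))).
    exact: measurable_funD.
  by apply/funext => x; case: (f x) (g x) => ? ? [].
Qed.

Lemma cmeasurableM (f g : T -> R[i]) :
  cmeasurable f -> cmeasurable g -> cmeasurable (fun x => f x * g x).
Proof.
move=> [f1 f2] [g1 g2]; split.
- rewrite (_ : (fun _ => _) = (fun x => complex.Re (f x) * complex.Re (g x) -
      complex.Im (f x) * complex.Im (g x))).
    by apply: measurable_funB; exact: measurable_funM.
  by apply/funext => x; case: (f x) (g x) => ? ? [].
- rewrite (_ : (fun _ => _) = (fun x => complex.Re (f x) * complex.Im (g x) +
      complex.Im (f x) * complex.Re (g x))).
    by apply: measurable_funD; exact: measurable_funM.
  by apply/funext => x; case: (f x) (g x) => ? ? [].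
Qed.

Lemma cmeasurableN (f : T -> R[i]) :
  cmeasurable f -> cmeasurable (fun x => - f x).
Proof.
move=> mf; have -> : (fun x => - f x) = (fun x => (-1) * f x).
  by apply/funext => x; rewrite mulN1r.
by apply: cmeasurableM => //; exact: cmeasurable_cst.
Qed.

Lemma cmeasurable_conj (f : T -> R[i]) :
  cmeasurable f -> cmeasurable (fun x => (f x)^*%C).
Proof.
move=> [f1 f2]; split.
- by rewrite (_ : (fun _ => _) = (fun x => complex.Re (f x)))//;
    apply/funext => x; case: (f x).
- rewrite (_ : (fun _ => _) = (fun x => - complex.Im (f x))).
    exact: measurable_funN.
  by apply/funext => x; case: (f x).
Qed.

Lemma cmeasurable_sum n (f : 'I_n -> T -> R[i]) :
  (forall i, cmeasurable (f i)) -> cmeasurable (fun x => \sum_i f i x).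
Proof.
elim: n f => [|n ih] f mf.
  rewrite (_ : (fun _ => _) = cst 0); first exact: cmeasurable_cst.
  by apply/funext => x; rewrite big_ord0.
rewrite (_ : (fun _ => _) = (fun x => f ord0 x + \sum_i f (lift ord0 i) x)).
  by apply: cmeasurableD => //; apply: ih.
by apply/funext => x; rewrite big_ord_recl.
Qed.

Lemma cmeasurable_mulmx m n p (A : T -> 'M[R[i]]_(m, n)) 
    (B : T -> 'M[R[i]]_(n, p)) :
  (forall i j, cmeasurable (fun x => A x i j)) ->
  (forall i j, cmeasurable (fun x => B x i j)) ->
  forall i j, cmeasurable (fun x => (A x *m B x) i j).
Proof.
move=> mA mB i j.
rewrite (_ : (fun _ => _) = (fun x => \sum_k A x i k * B x k j)).
  by apply: cmeasurable_sum => k; exact: cmeasurableM.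
by apply/funext => x; rewrite mxE.
Qed.

End ComplexMeasurable.

(** * Integrals of bounded complex functions over sets of finite measure *)

Section ComplexIntegral.
Variables (R : realType) (d : measure_display) (T : measurableType d).
Variables (nu : {measure set T -> \bar R}) (D : set T).
Hypotheses (mD : measurable D) (D_fin : (nu D < +oo)%E).

Lemma bounded_integrable (f : T -> R) (M : R) : measurable_fun D f ->
  (forall x, D x -> `|f x| <= M) -> nu.-integrable D (EFin \o f).
Proof.
move=> mf fM; apply/integrableP; split; first exact/measurable_EFinP.
apply: (@le_lt_trans _ _ (`|M|%:E * nu D)%E); last by rewrite lte_mul_pinfty.
apply: integral_le_bound => //; first exact/measurable_EFinP.
by apply: aeW => x Dx; rewrite lee_fin (le_trans (fM _ Dx))// ler_norm.
Qed.

(** The bound M makes g integrable, and then f, since |f| <= M + e. The estimate itself is the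
    integral of |f - g|, so M is absent from it. *)
Lemma Rintegral_approx (f g : T -> R) (M e : R) :
  measurable_fun D f -> measurable_fun D g ->
  (forall x, D x -> `|g x| <= M) -> (forall x, D x -> `|f x - g x| <= e) ->
  `|Rintegral nu D f - Rintegral nu D g| <= e * fine (nu D).
Proof.
move=> mf mg gM fg.
have ig := bounded_integrable mg gM.
have if_ : nu.-integrable D (EFin \o f).
  apply: (bounded_integrable (M := M + e)) => // x Dx.
  by rewrite -[f x](subrKC (g x)) (le_trans (ler_normD _ _))// lerD// ?gM ?fg.
rewrite -RintegralB// -Rintegral_cst//.
have mfg := measurable_funB mf mg.
have ifg : nu.-integrable D (EFin \o (f \- g)) by exact: bounded_integrable fg.
rewrite (le_trans (le_normr_Rintegral _ _))//.
apply: le_Rintegral => //.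
- apply: (bounded_integrable (M := e)); first exact: measurableT_comp.
  by move=> x Dx; rewrite normr_id fg.
- exact: (bounded_integrable (M := `|e|)).
Qed.

(** The real and imaginary parts each contribute e times the measure, hence the factor 2. *)
Lemma cintegral_approx (f g : T -> R[i]) (M e : R) :
  cmeasurable D f -> cmeasurable D g ->
  (forall x, D x -> normc (g x) <= M) ->
  (forall x, D x -> normc (f x - g x) <= e) ->
  normc (cintegral nu D f - cintegral nu D g) <= 2 * e * fine (nu D).
Proof.
move=> [f1 f2] [g1 g2] gM fg.
rewrite (le_trans (normc_le_ReIm _))//= -mulrA mulrDl mul1r; apply: lerD.
- apply: (Rintegral_approx (M := M)) => // x Dx.
    exact: le_trans (normr_Re_le_normc _) (gM _ Dx).
  rewrite (le_trans _ (fg _ Dx))// (le_trans _ (normr_Re_le_normc _))//.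
  by case: (f x) (g x) => ? ? [].
- apply: (Rintegral_approx (M := M)) => // x Dx.
    exact: le_trans (normr_Im_le_normc _) (gM _ Dx).
  rewrite (le_trans _ (fg _ Dx))// (le_trans _ (normr_Im_le_normc _))//.
  by case: (f x) (g x) => ? ? [].
Qed.

Lemma cintegral_cst (c : R[i]) :
  cintegral nu D (fun=> c) = (fine (nu D))%:C * c.
Proof.
rewrite /cintegral !Rintegral_cst//; case: c => a b /=.
by apply/eqP; rewrite eq_complex /= !mul0r subr0 addr0 ![fine _ * _]mulrC !eqxx.
Qed.

Lemma cintegralZ (c : R[i]) (f : T -> R[i]) (M : R) : cmeasurable D f ->
  (forall x, D x -> normc (f x) <= M) ->
  cintegral nu D (fun x => c * f x) = c * cintegral nu D f.
Proof.
move=> [f1 f2] fM.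
have i1 : nu.-integrable D (EFin \o (fun x => complex.Re (f x))).
  apply: (bounded_integrable (M := M)) => // x /fM.
  exact/le_trans/normr_Re_le_normc.
have i2 : nu.-integrable D (EFin \o (fun x => complex.Im (f x))).
  apply: (bounded_integrable (M := M)) => // x /fM.
  exact/le_trans/normr_Im_le_normc.
have i3 (a : R) (h : T -> R) : nu.-integrable D (EFin \o h) ->
    nu.-integrable D (EFin \o (fun x => a * h x)).
  by move=> ih; exact: (integrableZl mD a ih).
case: c => a b; rewrite /cintegral /=; congr (_ +i* _).
- rewrite -!RintegralZl// -RintegralB ?i3//.
  by apply: eq_Rintegral => x _; case: (f x).
- rewrite -!RintegralZl// -RintegralD ?i3//.
  by apply: eq_Rintegral => x _; case: (f x).
Qed.

Lemma cintegralD (f g : T -> R[i]) (M1 M2 : R) :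
  cmeasurable D f -> cmeasurable D g ->
  (forall x, D x -> normc (f x) <= M1) ->
  (forall x, D x -> normc (g x) <= M2) ->
  cintegral nu D (fun x => f x + g x) = cintegral nu D f + cintegral nu D g.
Proof.
move=> [f1 f2] [g1 g2] fM gM.
rewrite /cintegral; apply/eqP; rewrite eq_complex /=.
apply/andP; split; apply/eqP; (rewrite -RintegralD//;
  first by apply: eq_Rintegral => x _; case: (f x) (g x) => ? ? []).
- apply: (bounded_integrable (M := M1)) => // x /fM.
  exact/le_trans/normr_Re_le_normc.
- apply: (bounded_integrable (M := M2)) => // x /gM.
  exact/le_trans/normr_Re_le_normc.
- apply: (bounded_integrable (M := M1)) => // x /fM.
  exact/le_trans/normr_Im_le_normc.
- apply: (bounded_integrable (M := M2)) => // x /gM.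
  exact/le_trans/normr_Im_le_normc.
Qed.

Lemma cintegral_sum n (f : 'I_n -> T -> R[i]) (M : R) :
  (forall i, cmeasurable D (f i)) ->
  (forall i x, D x -> normc (f i x) <= M) ->
  cintegral nu D (fun x => \sum_i f i x) = \sum_i cintegral nu D (f i).
Proof.
elim: n f => [|n ih] f mf fM.
  rewrite big_ord0 (_ : (fun _ => _) = cst 0) ?cintegral_cst ?mulr0//.
  by apply/funext => x; rewrite big_ord0.
rewrite big_ord_recl -ih//; last by move=> i x; exact: fM.
rewrite (_ : (fun _ => _) = (fun x => f ord0 x + \sum_i f (lift ord0 i) x)).
  apply: (cintegralD (M1 := M) (M2 := \sum_(i < n) M)) => //.
  - exact: cmeasurable_sum.
  - exact: fM.
  - move=> x Dx; rewrite (le_trans (le_normc_sum _ _ _))//.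
    by apply: ler_sum => i _; exact: fM.
by apply/funext => x; rewrite big_ord_recl.
Qed.

End ComplexIntegral.

(** * Measurable dependence of an integral on a parameter *)

Section ParametricIntegral.
Variables (R : realType) (d1 d2 : measure_display).
Variables (T1 : measurableType d1) (T2 : measurableType d2).
Variables (m2 : {sigma_finite_measure set T2 -> \bar R}) (D : set T2).
Hypothesis mD : measurable D.

(** Extend f by 0 outside D. The integral is then [fine] of a difference of the integrals of the
    positive and negative parts, each measurable in the parameter by Tonelli. *)
Lemma measurable_fun_Rintegral (f : T1 * T2 -> R) : measurable_fun setT f ->
  measurable_fun setT (fun x => Rintegral m2 D (fun y => f (x, y))).
Proof.
move=> mf; pose g : T1 * T2 -> R := f \_ (setT `*` D).
have mg : measurable_fun setT (EFin \o g).
  apply/measurable_EFinP/(measurable_restrictT _ _).1.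
  - exact: measurableX.
  - exact: measurable_funTS.
rewrite (_ : (fun _ => _) = fine \o
    (fun x => fubini_F m2 (EFin \o g)^\+ x - fubini_F m2 (EFin \o g)^\- x)%E).
  apply: measurableT_comp => //; apply: emeasurable_funB;
    apply: measurable_fun_fubini_tonelli_F => //.
  + exact: measurable_funepos.
  + exact: measurable_funeneg.
apply/funext => x; rewrite /Rintegral integral_mkcond.
rewrite (_ : _ \_ D = (fun y => (EFin \o g) (x, y))); last first.
  by apply/funext => y; rewrite /= /g !patchE in_setX in_setT /=; case: ifP.
rewrite integralE; under eq_integral do rewrite funepos_comp/=.
by under [X in fine (_ - X) = _]eq_integral do rewrite funeneg_comp/=.
Qed.

Lemma cmeasurable_cintegral (f : T1 * T2 -> R[i]) : cmeasurable setT f ->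
  cmeasurable setT (fun x => cintegral m2 D (fun y => f (x, y))).
Proof.
move=> [f1 f2]; split.
- exact: (measurable_fun_Rintegral f1).
- exact: (measurable_fun_Rintegral f2).
Qed.

End ParametricIntegral.

(** * The matrix factor of the dyadic Green function *)

Section PolarTensor.
Variable R : realType.

(** The bracket that multiplies the scalar Green function, expressed through the unit vector v /
    r. *)
Definition polar_tensor (v : 'cV[R]_3) (k : R) : 'M[R[i]]_3 :=
  \matrix_(i, j)
    ((1 + mcoef (k * enorm v)) * (i == j)%:R -
     (1 + 3%:R * mcoef (k * enorm v)) *
       (v i 0 / enorm v * (v j 0 / enorm v))%:C).

Lemma dyadic_greenE (x y : 'cV[R]_3) (k : R) :
  dyadic_green x y k = green x y k *: polar_tensor (x - y) k.
Proof.
rewrite /dyadic_green; congr (_ *: _); apply/matrixP => i j.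
rewrite [RHS]mxE.
move: (x - y) => v; rewrite !mxE big_ord1 [v^T _ _]mxE mulr_natr.
by congr (_ - _ * _%:C); rewrite expr2 invfM; ring.
Qed.

(** The projection diag(1, 1, 0) onto the cross-range plane. *)
Definition cross_proj (i j : 'I_3) : R := ((i == j) && (i < 2)%N)%:R.

Lemma ord3_lt2 (i j : 'I_3) : (2 <= i)%N -> j != i -> (j < 2)%N.
Proof.
move=> i2 ji; rewrite ltn_neqAle -ltnS ltn_ord andbT.
apply: contra ji => /eqP j2; rewrite -val_eqE /= j2 eq_sym eqn_leq i2 andbT.
by rewrite -ltnS ltn_ord.
Qed.

Lemma enorm_sqr n (v : 'cV[R]_n) : enorm v ^+ 2 = \sum_i v i 0 ^+ 2.
Proof. by rewrite sqr_sqrtr// sumr_ge0// => i _; exact: sqr_ge0. Qed.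

(** Since |i t - 1| <= t + 1 and 1/t <= 2 e, the modulus is at most 1/t + 1/t^2 <= 2 e + 4 e^2 <= 3
    e. *)
Lemma mcoef_le (t e : R) : 0 < t -> e <= 1 / 4 -> 1 <= 2 * e * t ->
  normc (mcoef t) <= 3 * e.
Proof.
move=> t0 e4 et.
rewrite /mcoef Normc.normcM Normc.normcV normc_real ger0_norm ?sqr_ge0//.
rewrite ler_pdivrMr ?exprn_gt0//.
apply: (@le_trans _ _ (t + 1)).
  rewrite (le_trans (normc_le_ReIm _))//=.
  rewrite !(mul0r, mul1r, mulr0, addr0, subr0, add0r, sub0r) /=.
  by rewrite oppr0 sub0r normrN1 (gtr0_norm t0) addrC.
have t2 : 2 <= t by nra.
nra.
Qed.

(** Split the tensor into I - u u^T and m (I - 3 u u^T), with u = v / r. The first part is within 3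
    e of the projection: the cross-range entries of u are O(e), and in the corner 1 - u_3^2 = u_1^2
    + u_2^2. The second is at most 3 e times 4. *)
Lemma polar_tensor_approx (v : 'cV[R]_3) (k e : R) :
  0 < k -> 0 < e <= 1 / 8 -> 0 < enorm v ->
  (forall i : 'I_3, (i < 2)%N -> `|v i 0| <= 2 * e * enorm v) ->
  1 <= 2 * e * (k * enorm v) ->
  forall i j, normc (polar_tensor v k i j - (cross_proj i j)%:C) <= 15 * e.
Proof.
move=> k0 /andP[e0 e8] r0 hv hk i j.
have e4 : e <= 1 / 4 by lra.
have hm := mcoef_le (mulr_gt0 k0 r0) e4 hk.
set r := enorm v in r0 hv hk hm *; set m := mcoef (k * r) in hm *.
pose u (i : 'I_3) := v i 0 / r.
have usum : \sum_i u i ^+ 2 = 1.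
  rewrite (eq_bigr (fun i => r ^- 2 * v i 0 ^+ 2)); last first.
    by move=> l _; rewrite /u exprMn exprVn mulrC.
  by rewrite -mulr_sumr -enorm_sqr mulVf// expf_neq0// gt_eqF.
have u2 (l : 'I_3) : (l < 2)%N -> `|u l| <= 2 * e.
  by move=> l2; rewrite normrM normfV (gtr0_norm r0) ler_pdivrMr// hv.
have u1 l : `|u l| <= 1.
  rewrite -(ler_sqr (normr_ge0 _) ler01) real_normK ?num_real// expr1n -usum.
  by rewrite (bigD1 l)//= lerDl sumr_ge0// => ? _; exact: sqr_ge0.
have hD : `|(i == j)%:R - u i * u j - cross_proj i j| <= 3 * e.
  rewrite /cross_proj; have [<-{j}|ij] := eqVneq i j; last first.
    rewrite sub0r subr0 normrN normrM.
    have [i2|i2] := ltnP i 2.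
      have := ler_pM (normr_ge0 _) (normr_ge0 _) (u2 _ i2) (u1 j); lra.
    have j2 : (j < 2)%N by rewrite (ord3_lt2 i2)// eq_sym.
    have := ler_pM (normr_ge0 _) (normr_ge0 _) (u1 i) (u2 _ j2); lra.
  have [i2|i2] := ltnP i 2.
    rewrite /= addrAC subrr sub0r normrN normrM.
    have := ler_pM (normr_ge0 _) (normr_ge0 _) (u2 _ i2) (u1 i); lra.
  rewrite subr0 /= -[X in X - u i * u i]usum (bigD1 i)//= -expr2 addrAC subrr add0r.
  rewrite ger0_norm ?sumr_ge0//; last by move=> l _; exact: sqr_ge0.
  apply: (@le_trans _ _ (\sum_(l < 3 | l != i) e)); last first.
    by rewrite sumr_const cardC1 card_ord -mulr_natr /=; lra.
  apply: ler_sum => l li.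
  have l2 := ord3_lt2 i2 li.
  rewrite -real_normK ?num_real//.
  have := ler_pM (normr_ge0 _) (normr_ge0 _) (u2 _ l2) (u2 _ l2).
  by rewrite -expr2; nra.
have h4 : `|(i == j)%:R - 3 * (u i * u j)| <= 4.
  rewrite (le_trans (ler_normB _ _))// normrM (ger0_norm (ler0n _ _)) normrM.
  have h1 : (i == j)%:R <= 1 :> R by case: eqP.
  rewrite (ger0_norm (_ : 0 <= 3))//.
  have := ler_pM (normr_ge0 _) (normr_ge0 _) (u1 i) (u1 j); lra.
have -> : polar_tensor v k i j - (cross_proj i j)%:C =
    ((i == j)%:R - u i * u j - cross_proj i j)%:C +
    m * ((i == j)%:R - 3 * (u i * u j))%:C.
  rewrite mxE -/r -/m -/(u i) -/(u j) !rmorphB !rmorphM /= !rmorph_nat.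
  by ring.
rewrite (le_trans (le_normcD _ _))// Normc.normcM !normc_real.
have := ler_pM (normc_ge0 _) (normr_ge0 _) hm h4; lra.
Qed.

Lemma conj_mxE m n (A : 'M[R[i]]_(m, n)) i j : conj_mx A i j = (A i j)^*%C.
Proof. by rewrite mxE. Qed.

Lemma conj_mxZ m n a (A : 'M[R[i]]_(m, n)) :
  conj_mx (a *: A) = a^*%C *: conj_mx A.
Proof. by apply/matrixP => i j; rewrite !mxE conjcM. Qed.

(** The projection is real and idempotent. Each of the three products in an entry moves by at most e
    (1 + e) + e <= 4 e. *)
Lemma cross_proj_mulmx_approx (A B : 'M[R[i]]_3) (e : R) : 0 <= e <= 2 ->
  (forall i j, normc (A i j - (cross_proj i j)%:C) <= e) ->
  (forall i j, normc (B i j - (cross_proj i j)%:C) <= e) ->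
  forall i j, normc ((conj_mx A *m B) i j - (cross_proj i j)%:C) <= 12 * e.
Proof.
move=> /andP[e0 e2] hA hB i j.
have c1 a b : normc (cross_proj a b)%:C <= 1.
  by rewrite normc_real ger0_norm ?ler0n// lern1 leq_b1.
have -> : (cross_proj i j)%:C =
    \sum_l (cross_proj i l)%:C * (cross_proj l j)%:C :> R[i].
  rewrite (bigD1 i)//= big1 ?addr0; last first.
    by move=> l /negbTE li; rewrite /cross_proj eq_sym li mul0r.
  rewrite -rmorphM /=; congr _%:C; rewrite /cross_proj eqxx /=.
  by case: (i < 2)%N; rewrite ?andbT ?andbF ?mul1r ?mul0r.
rewrite mxE -sumrB (le_trans (le_normc_sum _ _ _))//.
apply: (@le_trans _ _ (\sum_(l < 3) 4 * e)); last first.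
  by rewrite sumr_const card_ord -mulr_natr; lra.
apply: ler_sum => l _; rewrite (le_trans (le_normc_mulB _ _ _ _))// conj_mxE.
have h1 : normc ((A i l)^*%C - (cross_proj i l)%:C) <= e.
  by rewrite -[X in _ - X]conjc_real -rmorphB normc_conj.
have h2 := hB l j; have := c1 i l; have := c1 l j.
have := normc_ge0 ((A i l)^*%C - (cross_proj i l)%:C).
have := normc_ge0 (B l j - (cross_proj l j)%:C).
have := normc_ge0 (cross_proj i l)%:C; have := normc_ge0 (cross_proj l j)%:C.
nra.
Qed.

End PolarTensor.

(** * Phase and amplitude of the product of two Green functions *)

Section GreenProduct.
Variable R : realType.

Definition fresnel_const (L : R) : R := (4 * pi * L) ^- 2.

Lemma fresnel_const_gt0 (L : R) : 0 < L -> 0 < fresnel_const L.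
Proof. by move=> L0; rewrite invr_gt0 exprn_gt0// !mulr_gt0// pi_gt0. Qed.

Lemma greenE (x y : 'cV[R]_3) (k : R) :
  green x y k = expi (k * enorm (x - y)) * ((4 * pi * enorm (x - y))^-1)%:C.
Proof. by rewrite /green fmorphV. Qed.

(** Dividing the difference of squares by r + r' gives (r' - r) - (z' - z) = -(z' - z) s / (r + r'),
    where s is the sum of the excesses r - (L + z) and r' - (L + z'). Thus k multiplies only z' - z,
    which Q controls; k times a single excess can be of order Theta_a, which is large. Finally s <=
    4 e L and r + r' >= L. *)
Lemma phase_approx (k L e Q z z' r r' : R) :
  0 < k -> 0 < L -> 0 < e <= 1 / 8 ->
  `|z| <= e * L -> `|z'| <= e * L -> k * `|z' - z| <= Q ->
  L + z <= r <= L + z + 2 * e * L -> L + z' <= r' <= L + z' + 2 * e * L ->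
  r' ^+ 2 - r ^+ 2 = (L + z') ^+ 2 - (L + z) ^+ 2 ->
  `|k * (r' - r) - k * (z' - z)| <= 4 * e * Q.
Proof.
move=> k0 L0 /andP[e0 e8] hz hz' hQ /andP[r1 r2] /andP[r1' r2'] rr.
have eL : e * L <= L / 8 by nra.
have [z1 z2] : - (e * L) <= z /\ z <= e * L.
  by move: hz; rewrite ler_norml => /andP.
have [z1' z2'] : - (e * L) <= z' /\ z' <= e * L.
  by move: hz'; rewrite ler_norml => /andP.
have s0 : 0 < r + r' by lra.
have E : (r' - r) - (z' - z) =
    - (z' - z) * (((r - (L + z)) + (r' - (L + z'))) / (r + r')).
  apply: (mulIf (lt0r_neq0 s0)); rewrite mulrA divfK ?lt0r_neq0//.
  have -> : (r' - r - (z' - z)) * (r + r') =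
      (r' ^+ 2 - r ^+ 2) - (z' - z) * (r + r').
    by ring.
  by rewrite rr; ring.
rewrite -mulrBr E mulNr mulrN normrN mulrA normrM normrM (gtr0_norm k0).
have q0 : 0 <= k * `|z' - z| by rewrite mulr_ge0// ltW.
rewrite (ger0_norm (_ : 0 <= _ / _)); last by rewrite divr_ge0 //; lra.
rewrite [leRHS]mulrC ler_pM//; first by rewrite divr_ge0//; lra.
by rewrite ler_pdivrMr//; nra.
Qed.

Lemma amplitude_approx (L e r r' : R) : 0 < L -> 0 < e <= 1 / 8 ->
  `|r - L| <= 3 * e * L -> `|r' - L| <= 3 * e * L ->
  `|L ^+ 2 / (r * r') - 1| <= 21 * e.
Proof.
move=> L0 /andP[e0 e8]; rewrite !ler_norml => /andP[r1 r2] /andP[r1' r2'].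
have eL : e * L <= L / 8 by nra.
(* As 3 e L <= 3 L / 8, both distances are at least 5 L / 8. *)
have rr : 25 / 64 * L ^+ 2 <= r * r' by nra.
have rr0 : 0 < r * r' by nra.
have -> : L ^+ 2 / (r * r') - 1 = (L ^+ 2 - r * r') / (r * r').
  by rewrite mulrBl divff// gt_eqF.
rewrite ler_pdivrMr// ler_pdivlMr//; apply/andP; split; nra.
Qed.

Lemma green_product_approx (x y y' : 'cV[R]_3) (k L e Q z z' : R) :
  0 < k -> 0 < L -> 0 < e <= 1 / 8 ->
  `|z| <= e * L -> `|z'| <= e * L -> k * `|z' - z| <= Q ->
  L + z <= enorm (x - y) <= L + z + 2 * e * L ->
  L + z' <= enorm (x - y') <= L + z' + 2 * e * L ->
  enorm (x - y') ^+ 2 - enorm (x - y) ^+ 2 = (L + z') ^+ 2 - (L + z) ^+ 2 ->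
  exists q : R[i],
    (green x y k)^*%C * green x y' k = (fresnel_const L)%:C * q /\
    normc (q - expi (k * (z' - z))) <= (21 + 8 * Q) * e.
Proof.
move=> k0 L0 he hz hz' hQ hr hr' rr.
have /andP[e0 e8] := he.
have eL : e * L <= L / 8 by nra.
have ph := phase_approx k0 L0 he hz hz' hQ hr hr' rr.
move: hz hz'; rewrite !ler_norml => /andP[z1 z2] /andP[z1' z2'].
move: hr hr'; set r := enorm (x - y); set r' := enorm (x - y').
move=> /andP[r1 r2] /andP[r1' r2'].
have am : `|L ^+ 2 / (r * r') - 1| <= 21 * e.
  by apply: amplitude_approx => //; rewrite ler_norml; apply/andP; split; lra.
(* The witness keeps the exact phase and the exact relative amplitude. The amplitude error gives 21
   e; the phase error 4 e Q, doubled by [expi_lipschitz], gives 8 Q e. *)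
exists (expi (k * (r' - r)) * (L ^+ 2 / (r * r'))%:C); split.
  rewrite !greenE -/r -/r' conjcM conjc_real mulrACA conj_expiM -mulrBr.
  rewrite [RHS]mulrCA -!rmorphM /=; congr (_ * _%:C); rewrite /fresnel_const.
  have p0 : pi != 0 :> R by rewrite gt_eqF// pi_gt0.
  have r0 : r != 0 by rewrite gt_eqF//; lra.
  have r0' : r' != 0 by rewrite gt_eqF//; lra.
  have L0' : L != 0 by rewrite gt_eqF.
  by move: (pi : R) p0 => u p0; field; rewrite p0 r0 r0' L0'.
set a := expi _; set b := expi (k * (z' - z)); set c := _ / _.
have -> : a * c%:C - b = a * (c - 1)%:C + (a - b).
  by rewrite rmorphB rmorph1; ring.
rewrite (le_trans (le_normcD _ _))// Normc.normcM normc_expi mul1r normc_real.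
have := expi_lipschitz (k * (r' - r)) (k * (z' - z)); lra.
Qed.

Lemma enorm_point3 (x ys : R * R) (w : R) :
  enorm (point3 x 0 - point3 ys w) ^+ 2 =
  (x.1 - ys.1) ^+ 2 + (x.2 - ys.2) ^+ 2 + w ^+ 2.
Proof.
by rewrite enorm_sqr !big_ord_recl big_ord0 !mxE /= addr0 sub0r sqrrN addrA.
Qed.

(** By Pythagoras r^2 exceeds (L + z)^2 by at most 2 (e L)^2, which the cross term of (L + z + 2 e
    L)^2 dominates. *)
Lemma enorm_window (x ys : R * R) (L e z : R) : 0 < L -> 0 < e <= 1 / 8 ->
  `|z| <= e * L -> `|x.1 - ys.1| <= e * L -> `|x.2 - ys.2| <= e * L ->
  L + z <= enorm (point3 x 0 - point3 ys (L + z)) <= L + z + 2 * e * L.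
Proof.
move=> L0 /andP[e0 e8] hz h1 h2.
have eL : e * L <= L / 8 by nra.
move: hz; rewrite ler_norml => /andP[z1 z2].
have n0 : 0 <= enorm (point3 x 0 - point3 ys (L + z)) by exact: sqrtr_ge0.
have s1 : (x.1 - ys.1) ^+ 2 <= (e * L) ^+ 2.
  by rewrite -real_normK ?num_real// ler_sqr ?nnegrE// ltW// mulr_gt0.
have s2 : (x.2 - ys.2) ^+ 2 <= (e * L) ^+ 2.
  by rewrite -real_normK ?num_real// ler_sqr ?nnegrE// ltW// mulr_gt0.
have t1 := sqr_ge0 (x.1 - ys.1); have t2 := sqr_ge0 (x.2 - ys.2).
have w0 : 0 < L + z by lra.
have eL0 : 0 < e * L by rewrite mulr_gt0.
apply/andP; split.
  rewrite -ler_sqr ?nnegrE ?(ltW w0)// enorm_point3; lra.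
rewrite -ler_sqr ?nnegrE//; last by lra.
by rewrite enorm_point3; nra.
Qed.

(** The scalar factor has error A <= (21 + 8 Q) e, the matrix factor B <= 12 * 15 e = 180 e <= 22.5.
    The product rule gives 24 A + B, that is 24 * 21 + 180 = 684 and 24 * 8 = 192. *)
Lemma green_mulmx_approx (x ys : R * R) (k L e Q z z' : R) :
  0 < k -> 0 < L -> 0 < e <= 1 / 8 -> 1 <= e * (k * L) ->
  `|x.1 - ys.1| <= e * L -> `|x.2 - ys.2| <= e * L ->
  `|z| <= e * L -> `|z'| <= e * L -> k * `|z' - z| <= Q ->
  forall i j,
  normc ((conj_mx (dyadic_green (point3 x 0) (point3 ys (L + z)) k) *m
          dyadic_green (point3 x 0) (point3 ys (L + z')) k) i j -
         (fresnel_const L)%:C * (expi (k * (z' - z)) * (cross_proj R i j)%:C))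
  <= fresnel_const L * ((684 + 192 * Q) * e).
Proof.
move=> k0 L0 he hk hx1 hx2 hz hz' hQ i j.
have /andP[e0 e8] := he.
have eL : e * L <= L / 8 by nra.
have Q0 : 0 <= Q by apply: le_trans hQ; rewrite mulr_ge0// ltW.
have hr := enorm_window L0 he hz hx1 hx2.
have hr' := enorm_window L0 he hz' hx1 hx2.
have rr : enorm (point3 x 0 - point3 ys (L + z')) ^+ 2 -
    enorm (point3 x 0 - point3 ys (L + z)) ^+ 2 = (L + z') ^+ 2 - (L + z) ^+ 2.
  by rewrite !enorm_point3; ring.
have [q [gq hq]] := green_product_approx k0 L0 he hz hz' hQ hr hr' rr.
have pol w : `|w| <= e * L -> forall a b,
    normc (polar_tensor (point3 x 0 - point3 ys (L + w)) k a b
           - (cross_proj R a b)%:C) <= 15 * e.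
  move=> hw; have /andP[n1 _] := enorm_window L0 he hw hx1 hx2.
  move: hw; rewrite ler_norml => /andP[w1 w2].
  (* Since r >= L + w >= 7 L / 8, a cross-range offset of at most e L is at most 2 e r. *)
  apply: polar_tensor_approx => //; first by lra.
    move=> -[[|[|//]] hl] _; rewrite !mxE /=.
    - by rewrite (le_trans hx1)//; nra.
    - by rewrite (le_trans hx2)//; nra.
  by nra.
set G := dyadic_green _ _ _; set G' := dyadic_green _ _ _.
have -> : (conj_mx G *m G') i j = (fresnel_const L)%:C *
    (q * (conj_mx (polar_tensor (point3 x 0 - point3 ys (L + z)) k) *m
          polar_tensor (point3 x 0 - point3 ys (L + z')) k) i j).
  rewrite /G /G' !dyadic_greenE conj_mxZ -scalemxAl -scalemxAr scalerA gq.
  by rewrite mxE mulrA.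
rewrite -mulrBr Normc.normcM normc_real gtr0_norm ?fresnel_const_gt0//.
rewrite ler_wpM2l//; first exact/ltW/fresnel_const_gt0.
have e15 : 0 <= 15 * e <= 2 by lra.
have hP := cross_proj_mulmx_approx e15 (pol _ hz) (pol _ hz') i j.
rewrite (le_trans (le_normc_mulB _ _ _ _))// normc_expi mul1r.
have c1 : normc (cross_proj R i j)%:C <= 1.
  by rewrite normc_real ger0_norm ?ler0n// lern1 leq_b1.
move: hq hP c1.
set A := normc _; set B := normc (_ - _); set c := normc _ => hA hB hc.
have A0 : 0 <= A := normc_ge0 _; have B0 : 0 <= B := normc_ge0 _.
have hcB : c + B <= 24 by lra.
have := ler_wpM2l A0 hcB.
lra.
Qed.

End GreenProduct.

(** * Measurability of the dyadic Green function *)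

Section GreenMeasurable.
Variables (R : realType) (d : measure_display) (T : measurableType d).
Variables (x y : T -> 'cV[R]_3) (k : T -> R).
Hypothesis mxy : forall i, measurable_fun setT (fun t => (x t - y t) i 0).
Hypothesis mk : measurable_fun setT k.

Lemma measurable_enorm : measurable_fun setT (fun t => enorm (x t - y t)).
Proof.
apply: measurable_fun_sqrt.
rewrite (_ : (fun _ => _) = (fun t => (x t - y t) 0 0 ^+ 2 +
    ((x t - y t) 1 0 ^+ 2 + (x t - y t) (1 + 1) 0 ^+ 2))).
  by do 2![apply: measurable_funD; first exact: measurable_funX];
    exact: measurable_funX.
apply/funext => t; rewrite !big_ord_recl big_ord0 addr0.
by congr (_ ^+ 2 + (_ ^+ 2 + _ ^+ 2)); congr (_ _ 0); exact: val_inj.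
Qed.

Lemma cmeasurable_dyadic_green i j :
  cmeasurable setT (fun t => dyadic_green (x t) (y t) (k t) i j).
Proof.
have mr := measurable_enorm.
have mkr := measurable_funM mk mr.
have mm : cmeasurable setT (fun t => mcoef (k t * enorm (x t - y t))).
  rewrite (_ : (fun _ => _) = fun t => ('i * (k t * enorm (x t - y t))%:C + -1) *
      (((k t * enorm (x t - y t)) ^+ 2)^-1)%:C); last first.
    by apply/funext => t; rewrite /mcoef fmorphV.
  apply: cmeasurableM; last first.
    exact/cmeasurable_real/measurable_funV/measurable_funX.
  apply: cmeasurableD; last exact: cmeasurable_cst.
  by apply: cmeasurableM; [exact: cmeasurable_cst|exact: cmeasurable_real].
have mu l : measurable_fun setT (fun t => (x t - y t) l 0 / enorm (x t - y t)).
  by apply: measurable_funM => //; exact: measurable_funV.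
rewrite (_ : (fun _ => _) = fun t =>
  expi (k t * enorm (x t - y t)) * ((4 * pi * enorm (x t - y t))^-1)%:C *
  ((1 + mcoef (k t * enorm (x t - y t))) * (i == j)%:R +
    - ((1 + 3%:R * mcoef (k t * enorm (x t - y t))) *
       ((x t - y t) i 0 / enorm (x t - y t) *
        ((x t - y t) j 0 / enorm (x t - y t)))%:C))); last first.
  apply/funext => t.
  by rewrite dyadic_greenE [LHS]mxE greenE [polar_tensor _ _ _ _]mxE.
have mc := @cmeasurable_cst R d T setT.
apply: cmeasurableM.
  apply: cmeasurableM; first exact: cmeasurable_expi.
  by apply/cmeasurable_real/measurable_funV; exact: measurable_funM.
apply: cmeasurableD.
  by apply: cmeasurableM => //; exact: cmeasurableD.
apply: cmeasurableN; apply: cmeasurableM.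
  by apply: cmeasurableD => //; exact: cmeasurableM.
by apply: cmeasurable_real; exact: measurable_funM.
Qed.

End GreenMeasurable.

(** * Oscillatory integrals over the frequency band *)

Section Exponential.
Variable R : realType.

Lemma band_itv (P : params R) : band P =
  `]freq0 P - bandw P / 2, freq0 P + bandw P / 2[%classic.
Proof.
by rewrite /band; apply/seteqP; split => w /=; rewrite in_itv /= ltr_distl.
Qed.

(** The endpoints are null, so the fundamental theorem on the closed interval applies. A bounded
    primitive gives a bound independent of the length of the interval. *)
Lemma Rintegral_FTC_bound (F f : R -> R) (a b M : R) : a < b ->
  (forall x : R, is_derive x 1 F (f x)) -> continuous f ->
  (forall x, `|F x| <= M) ->
  `|Rintegral (@lebesgue_measure R) `]a, b[ f| <= 2 * M.
Proof.
move=> ab dF cf FM.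
have cF : continuous F.
  move=> x; apply: differentiable_continuous; apply/derivable1_diffP.
  exact: ex_derive.
have icc : (@lebesgue_measure R).-integrable `[a, b] (EFin \o f).
  apply: continuous_compact_integrable; first exact: segment_compact.
  exact: continuous_subspaceT.
rewrite Rintegral_itv_bndo_bndc; last first.
  by apply: integrableS icc => //; exact: subset_itv_oo_cc.
rewrite Rintegral_itv_obnd_cbnd; last first.
  by apply: integrableS icc => //; exact: subset_itv_oc_cc.
rewrite /Rintegral (@continuous_FTC2 _ _ F)//.
- by rewrite -EFinB /= (le_trans (ler_normB _ _))// mulrDl mul1r lerD.
- exact: continuous_subspaceT.
- split.
  + by move=> x _; exact: ex_derive.
  + by apply: cvg_at_right_filter; exact: cF.
  + by apply: cvg_at_left_filter; exact: cF.
- by move=> x _; rewrite derive1E; exact: derive_val.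
Qed.

(** The primitives sin(w t) / t and - cos(w t) / t are bounded by 1 / |t|; each part contributes 2 /
    |t|. This is the source of the decay in range. *)
Lemma cintegral_expi_le (a b t : R) : a < b -> t != 0 ->
  normc (cintegral (@lebesgue_measure R) `]a, b[ (fun w => expi (w * t))) <=
  4 / `|t|.
Proof.
move=> ab t0; rewrite (le_trans (normc_le_ReIm _))//=.
have ct : continuous (fun w : R => w * t) by move=> w; exact: mulrr_continuous.
have dt (w : R) : is_derive w 1 (fun w : R => w * t) t.
  have -> : (fun w : R => w * t) = (t \*: id).
    by apply/funext => u /=; rewrite mulrC.
  by apply: is_derive_eq; rewrite /GRing.scale /= mulr1.
have -> : 4 / `|t| = 2 * `|t|^-1 + 2 * `|t|^-1 by ring.
have sc (u : R -> R) (w : R) : (forall w, `|u w| <= 1) -> `|t^-1 * u w| <= `|t|^-1.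
  by move=> hu; rewrite normrM normfV ler_piMr.
apply: lerD.
- apply: (@Rintegral_FTC_bound (fun w => t^-1 * sin (w * t))) => //.
  + move=> w; have := @is_derive1_comp R sin (fun u => u * t) w _ _
      (is_derive_sin (w * t)) (dt w).
    move/(is_deriveZ t^-1) => /is_derive_eq; apply.
    by rewrite /GRing.scale /= mulrCA mulVf// mulr1.
  + by move=> w; apply: continuous_comp; [exact: ct|exact: continuous_cos].
  + by move=> w; apply: (sc (fun w => sin (w * t))) => ?; exact: sin_max.
- apply: (@Rintegral_FTC_bound (fun w => - (t^-1 * cos (w * t)))) => //.
  + move=> w; have := @is_derive1_comp R cos (fun u => u * t) w _ _
      (is_derive_cos (w * t)) (dt w).
    move/(is_deriveZ t^-1)/is_deriveN => /is_derive_eq; apply.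
    by rewrite /GRing.scale /= mulNr mulrN opprK mulrCA mulVf// mulr1.
  + by move=> w; apply: continuous_comp; [exact: ct|exact: continuous_sin].
  + move=> w; rewrite normrN.
    by apply: (sc (fun w => cos (w * t))) => ?; exact: cos_max.
Qed.

End Exponential.

(** * Approximation of iterated integrals *)

Section DoubleIntegral.
Variables (R : realType) (d1 d2 : measure_display).
Variables (T1 : measurableType d1) (T2 : measurableType d2).
Variables (m1 : {measure set T1 -> \bar R}).
Variables (m2 : {sigma_finite_measure set T2 -> \bar R}).
Variables (D1 : set T1) (D2 : set T2).
Hypotheses (mD1 : measurable D1) (D1_fin : (m1 D1 < +oo)%E).
Hypotheses (mD2 : measurable D2) (D2_fin : (m2 D2 < +oo)%E).

Lemma cmeasurable_pair1 (F : T1 * T2 -> R[i]) (w : T1) :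
  cmeasurable setT F -> cmeasurable D2 (fun x => F (w, x)).
Proof.
move=> [F1 F2]; split; apply: measurable_funTS.
- exact: (measurableT_comp F1 (pair1_measurable w)).
- exact: (measurableT_comp F2 (pair1_measurable w)).
Qed.

(* The factor [s] accommodates the normalization by [perm * w^2] that the image
   applies outside the inner integral. *)
Lemma double_cintegral_approx (s g : T1 -> R[i]) (F : T1 * T2 -> R[i])
    (M E : R) :
  cmeasurable setT F -> cmeasurable D1 s -> cmeasurable D1 g ->
  (forall w, D1 w -> s w != 0) ->
  (forall w, D1 w -> normc (g w) <= M) ->
  (forall w x, D1 w -> D2 x -> normc (s w * F (w, x) - g w) <= E) ->
  normc (cintegral m1 D1 (fun w => s w * cintegral m2 D2 (fun x => F (w, x))) -
         (fine (m2 D2))%:C * cintegral m1 D1 g)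
  <= 4 * E * fine (m2 D2) * fine (m1 D1).
Proof.
move=> mF ms mg s0 gM FE.
set a := fine (m2 D2).
have a0 : 0 <= a by rewrite fine_ge0.
rewrite -(cintegralZ mD1 D1_fin _ mg gM).
have -> : 4 * E * a * fine (m1 D1) = 2 * (2 * E * a) * fine (m1 D1) by ring.
apply: (cintegral_approx mD1 D1_fin (M := a * M)) => //.
- apply: cmeasurableM => //.
  have [h1 h2] := cmeasurable_cintegral m2 mD2 mF.
  by split; exact: measurable_funTS.
- by apply: cmeasurableM => //; exact: cmeasurable_cst.
- move=> w Dw; rewrite Normc.normcM normc_real ger0_norm// ler_wpM2l//.
  exact: gM.
move=> w Dw.
have sw : 0 < normc (s w).
  rewrite lt_neqAle normc_ge0 andbT eq_sym.
  by apply: contra (s0 w Dw) => /eqP/Normc.eq0_normc/eqP.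
(* The inner integrand is compared with the constant g w / s w, with error E / |s w|; multiplying by
   s w restores E. Each of the two integrations doubles the error, hence the 4. *)
have := @cintegral_approx R _ _ m2 D2 mD2 D2_fin (fun x => F (w, x))
  (fun=> g w / s w) (normc (g w / s w)) (E / normc (s w))
  (cmeasurable_pair1 w mF) (cmeasurable_cst _ _) (fun _ _ => lexx _).
rewrite cintegral_cst// -/a => H.
have -> : s w * cintegral m2 D2 (fun x => F (w, x)) - a%:C * g w =
    s w * (cintegral m2 D2 (fun x => F (w, x)) - a%:C * (g w / s w)).
  by rewrite mulrBr; congr (_ - _); rewrite mulrCA [s w * _]mulrC divfK// s0.
rewrite Normc.normcM mulrC -ler_pdivlMr//.
have -> : 2 * E * a / normc (s w) = 2 * (E / normc (s w)) * a by ring.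
apply: H => x Dx; rewrite ler_pdivlMr// -Normc.normcM mulrC mulrBr.
by rewrite [s w * (_ / _)]mulrC divfK ?s0//; exact: FE.
Qed.

End DoubleIntegral.

(** * Measure of the array and of the band *)

Section PlaneMeasure.
Variable R : realType.
Local Notation mu := (@lebesgue_measure R).
Local Notation plane := (measurableTypeR R * measurableTypeR R)%type.

Definition disk (r : R) : set (R * R) := [set x | norm2 x <= r].

Lemma measurable_disk r : measurable (disk r : set plane).
Proof.
have mn : measurable_fun setT (@norm2 R).
  by apply: measurable_fun_sqrt; apply: measurable_funD; exact: measurable_funX.
have := mn measurableT `]-oo, r]%classic (measurable_itv _).
by rewrite setTI (_ : _ @^-1` _ = disk r).
Qed.

Lemma disk_coord_le r x : disk r x -> `|x.1| <= r /\ `|x.2| <= r.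
Proof.
rewrite /disk /= => xr; have n0 : 0 <= norm2 x := sqrtr_ge0 _.
by split; apply: le_trans xr; rewrite -ler_sqr ?nnegrE// real_normK ?num_real//
  sqr_sqrtr ?addr_ge0 ?sqr_ge0// ?lerDl ?lerDr sqr_ge0.
Qed.

Lemma disk_lty r : ((mu \x mu) (disk r) < +oo)%E.
Proof.
pose I := `[- r, r]%classic.
have mI : measurable (I : set (measurableTypeR R)) by exact: measurable_itv.
apply: (@le_lt_trans _ _ ((mu \x mu) (I `*` I))%E).
  apply: le_measure; rewrite ?inE; first exact: measurable_disk.
    exact: measurableX.
  move=> x /disk_coord_le[h1 h2].
  by split; rewrite /I /= in_itv /= -ler_norml.
rewrite product_measure1E//= (_ : mu I = mu [set` `[- r, r]])//.
rewrite !lebesgue_measure_itv /=.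
by case: ifP => _; rewrite ?mule0 ?ltry// -EFinD -EFinM ltry.
Qed.

Lemma disk_gt0 r : 0 < r -> 0 < fine ((mu \x mu) (disk r))%E.
Proof.
move=> r0; apply: fine_gt0; rewrite disk_lty andbT.
(* The square [0, r/2]^2 has positive measure and lies in the disk, as r^2/4 + r^2/4 <= r^2. *)
pose I := `[0, r / 2]%classic.
have mI : measurable (I : set (measurableTypeR R)) by exact: measurable_itv.
apply: (@lt_le_trans _ _ ((mu \x mu) (I `*` I))%E).
  rewrite product_measure1E//= (_ : mu I = mu [set` `[0, r / 2]])//.
  rewrite !lebesgue_measure_itv /= lte_fin divr_gt0//.
  by rewrite -EFinD -EFinM lte_fin subr0 mulr_gt0// divr_gt0.
apply: le_measure; rewrite ?inE; last 2 first.
- exact: measurable_disk.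
- move=> x []; rewrite /I /= !in_itv /= => /andP[h1 h2] /andP[h3 h4].
  rewrite /disk /= -ler_sqr ?nnegrE ?sqrtr_ge0 ?(ltW r0)// sqr_sqrtr; nra.
- exact: measurableX.
Qed.

(* The library's sigma-finite instance on [\x] is shadowed by the one for
   subprobabilities. *)
Definition plane_measure : set plane -> \bar R := (mu \x mu)%E.

HB.instance Definition _ := Measure.on plane_measure.

Let plane_measure_sigma_finite : sigma_finite setT plane_measure.
Proof.
exists (fun n => disk n%:R).
  apply/esym/seteqP; split => // x _; exists (Num.bound (norm2 x)) => //=.
  exact/ltW/archi_boundP/sqrtr_ge0.
by move=> n; split; [exact: measurable_disk|exact: disk_lty].
Qed.

HB.instance Definition _ := Measure_isSigmaFinite.Build _ _ _ plane_measure
  plane_measure_sigma_finite.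

Lemma measurable_band (P : params R) :
  measurable (band P : set (measurableTypeR R)).
Proof. by rewrite band_itv; exact: measurable_itv. Qed.

Lemma lebesgue_band (P : params R) :
  0 < bandw P -> mu (band P) = (bandw P)%:E.
Proof.
move=> b0; rewrite band_itv lebesgue_measure_itv /= lte_fin ifT; last by lra.
by rewrite -EFinD; congr _%:E; lra.
Qed.

Lemma band_array_approx (P : params R) (s g : R -> R[i])
    (F : R -> R * R -> R[i]) (M E : R) : 0 < bandw P ->
  @cmeasurable R _ (measurableTypeR R * plane)%type setT
    (fun u => F u.1 u.2) ->
  @cmeasurable R _ (measurableTypeR R) (band P) s ->
  @cmeasurable R _ (measurableTypeR R) (band P) g ->
  (forall w, band P w -> s w != 0) ->
  (forall w, band P w -> normc (g w) <= M) ->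
  (forall w x, band P w -> array P x -> normc (s w * F w x - g w) <= E) ->
  normc (cintegral mu (band P)
           (fun w => s w * cintegral (mu \x mu)%E (array P) (F w)) -
         (fine ((mu \x mu)%E (array P)))%:C * cintegral mu (band P) g)
  <= 4 * E * fine ((mu \x mu)%E (array P)) * bandw P.
Proof.
move=> b0 mF ms mg s0 gM FE.
have bfin : (mu (band P) < +oo)%E by rewrite lebesgue_band// ltry.
rewrite [X in _ <= _ * X](_ : _ = fine (mu (band P))); last first.
  by rewrite lebesgue_band.
exact: (@double_cintegral_approx R _ _ _ _ mu plane_measure _ _
  (measurable_band P) bfin (measurable_disk (arad P)) (disk_lty (arad P))
  s g _ M E mF ms mg s0 gM FE).
Qed.

End PlaneMeasure.

(** * The linear system at fixed parameters, with explicit errors *)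

Section PolarizationSystem.
Variables (R : realType) (P : params R) (Kb Kh e Q : R).
Local Notation mu := (@lebesgue_measure R).
Local Notation L := (dist P).
Local Notation plane := (measurableTypeR R * measurableTypeR R)%type.
Local Notation C := (684 + 192 * Q).

Hypothesis admP : admissible P.
Hypothesis he : 0 < e <= 1 / 8.
Hypothesis cross_small : arad P + Kb * bwin P <= e * L.
Hypothesis range_small : Kh * hwin P <= e * L.
Hypothesis kL_large : forall w, closed_band P w -> 1 <= e * (wavenum P w * L).
Hypothesis kh_bounded :
  forall w, closed_band P w -> 2 * (wavenum P w * (Kh * hwin P)) <= Q.

Variable ys : R * R.
Hypothesis hys : norm2 ys <= Kb * bwin P.

Let L_gt0 : 0 < L. Proof. by case: admP => _ [[]]. Qed.
Let B_gt0 : 0 < bandw P. Proof. by case: admP => _ [_ []]. Qed.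
Let speed_gt0 : 0 < speed P. Proof. by case: admP => -[]. Qed.
Let perm_gt0 : 0 < perm P. Proof. by case: admP => -[]. Qed.

Lemma band_sub w : band P w -> closed_band P w /\ 0 < w.
Proof.
rewrite /band /closed_band /= ltr_distl => /andP[h1 h2].
have [_ [_ [_ h3]]] := admP.
by split; [apply/andP; split; exact: ltW|exact: lt_trans h1].
Qed.

(** The physical lengths enter here: cross-range offsets are at most a + Kb b <= e L, and k |z' - z|
    <= 2 k Kh h <= Q. *)
Lemma band_dyadic_mulmx_approx (z z' w : R) x i j :
  `|z| <= Kh * hwin P -> `|z'| <= Kh * hwin P -> band P w -> array P x ->
  normc ((conj_mx (dyadic_green (point3 x 0) (point3 ys (L + z)) (wavenum P w)) *m
          dyadic_green (point3 x 0) (point3 ys (L + z')) (wavenum P w)) i j -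
         (fresnel_const L)%:C *
           (expi (w * ((z' - z) / speed P)) * (cross_proj R i j)%:C))
  <= fresnel_const L * (C * e).
Proof.
move=> hz hz' /band_sub[cw w0] /disk_coord_le[h1 h2].
have k0 : 0 < wavenum P w by rewrite divr_gt0.
have n0 : 0 <= norm2 ys := sqrtr_ge0 _.
have y1 : `|ys.1| <= norm2 ys.
  by rewrite -ler_sqr ?nnegrE// real_normK ?num_real// sqr_sqrtr
    ?addr_ge0 ?sqr_ge0// lerDl sqr_ge0.
have y2 : `|ys.2| <= norm2 ys.
  by rewrite -ler_sqr ?nnegrE// real_normK ?num_real// sqr_sqrtr
    ?addr_ge0 ?sqr_ge0// lerDr sqr_ge0.
have -> : w * ((z' - z) / speed P) = wavenum P w * (z' - z).
  by rewrite /wavenum; ring.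
apply: green_mulmx_approx => //.
- exact: kL_large.
- rewrite (le_trans (ler_normB _ _))// (le_trans _ cross_small)//.
  by rewrite lerD// (le_trans y1).
- rewrite (le_trans (ler_normB _ _))// (le_trans _ cross_small)//.
  by rewrite lerD// (le_trans y2).
- exact: le_trans range_small.
- exact: le_trans range_small.
- have := kh_bounded cw; apply: le_trans.
  rewrite mulrCA ler_wpM2l ?(ltW k0)// (le_trans (ler_normB _ _))//; lra.
Qed.

Lemma cmeasurable_dyadic z i j :
  cmeasurable setT (fun u : measurableTypeR R * plane =>
    dyadic_green (point3 u.2 0) (point3 ys (L + z)) (wavenum P u.1) i j).
Proof.
apply: (@cmeasurable_dyadic_green _ _ _
  (fun u : measurableTypeR R * plane => point3 u.2 0)
  (fun=> point3 ys (L + z)) (fun u => wavenum P u.1)).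
  move=> {}i; rewrite (_ : (fun _ => _) = fun u : measurableTypeR R * plane =>
      [:: u.2.1; u.2.2; 0]`_i - (point3 ys (L + z)) i 0); last first.
    by apply/funext => u; rewrite !mxE.
  apply: measurable_funB => //.
  case: i => -[|[|[|//]]] ? /=.
  - exact: (measurableT_comp measurable_fst measurable_snd).
  - exact: (measurableT_comp measurable_snd measurable_snd).
  - exact: measurable_cst.
by apply: measurable_funM => //; exact: measurable_fst.
Qed.

Lemma cmeasurable_dyadic_mulmx z z' i j :
  cmeasurable setT (fun u : measurableTypeR R * plane =>
    (conj_mx (dyadic_green (point3 u.2 0) (point3 ys (L + z)) (wavenum P u.1)) *m
     dyadic_green (point3 u.2 0) (point3 ys (L + z')) (wavenum P u.1)) i j).
Proof.
apply: cmeasurable_mulmx => a b; last exact: cmeasurable_dyadic.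
rewrite (_ : (fun _ => _) = fun u : measurableTypeR R * plane =>
    (dyadic_green (point3 u.2 0) (point3 ys (L + z)) (wavenum P u.1) a b)^*%C); last first.
  by apply/funext => u; rewrite conj_mxE.
exact/cmeasurable_conj/cmeasurable_dyadic.
Qed.

Let a := fine ((mu \x mu)%E (array P)).
Let beta := a * fresnel_const L * bandw P.

Let arad_gt0 : 0 < arad P. Proof. by case: admP => -[]. Qed.
Let a_gt0 : 0 < a. Proof. exact: disk_gt0. Qed.
Let beta_gt0 : 0 < beta.
Proof. by rewrite !mulr_gt0// fresnel_const_gt0. Qed.

Let band_lty : (mu (band P) < +oo)%E.
Proof. by rewrite lebesgue_band// ltry. Qed.

Lemma cross_proj_lshift (i j : 'I_2) :
  cross_proj R (lshift 1 i) (lshift 1 j) = (i == j)%:R.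
Proof. by rewrite /cross_proj -val_eqE /= ltn_ord andbT. Qed.

(** For z' = z the phase is 1, so the integrand is nearly constant and integrates to [beta] times
    the identity. The 4 is the cost of the double integration. *)
Lemma system_mx_approx z i j : `|z| <= Kh * hwin P ->
  normc (system_mx P (point3 ys (L + z)) i j - beta%:C * (i == j)%:R)
  <= beta * (4 * C * e).
Proof.
move=> hz; pose i3 := lshift 1 i : 'I_3; pose j3 := lshift 1 j : 'I_3.
set y := point3 ys (L + z).
pose F w (x : R * R) :=
  (conj_mx (dyadic_green (point3 x 0) y (wavenum P w)) *m
     dyadic_green (point3 x 0) y (wavenum P w)) i3 j3.
have -> : system_mx P y i j = cintegral mu (band P) (fun w =>
    1 * cintegral (mu \x mu)%E (array P) (F w)).
  rewrite mxE; congr cintegral; apply/funext => w.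
  by rewrite mul1r !mxE.
pose c : R[i] := (fresnel_const L * (i == j)%:R)%:C.
have := @band_array_approx R P (fun=> 1) (fun=> c) F (normc c)
  (fresnel_const L * (C * e)) B_gt0.
rewrite cintegral_cst//; last exact: measurable_band.
rewrite -/a (congr1 fine (lebesgue_band B_gt0)) => H.
have -> : beta%:C * (i == j)%:R = a%:C * ((bandw P)%:C * c).
  rewrite /c -(rmorph_nat (real_complex R)) -!rmorphM /=; congr _%:C.
  by rewrite /beta; ring.
have -> : beta * (4 * C * e) = 4 * (fresnel_const L * (C * e)) * a * bandw P.
  by rewrite /beta; ring.
apply: H => //.
  exact: cmeasurable_dyadic_mulmx.
move=> w x bw ax; rewrite mul1r.
have := band_dyadic_mulmx_approx i3 j3 hz hz bw ax.
by rewrite subrr mul0r mulr0 expi0 mul1r /i3 /j3 cross_proj_lshift -rmorphM.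
Qed.

Section Image.
Variables (N : nat) (eta : 'I_N -> R) (pd : 'I_N -> 'cV[R[i]]_3) (Kp z : R).
Hypothesis heta : forall j, `|eta j| <= Kh * hwin P.
Hypothesis hpd : forall j, cnorm (pd j) <= Kp.
Hypothesis hz : `|z| <= Kh * hwin P.
Local Notation yd := (fun j => point3 ys (L + eta j)).
Local Notation y := (point3 ys (L + z)).

(** The function phi: the Fourier integral of the indicator of the band at t / c. *)
Definition band_phase (t : R) : R[i] :=
  cintegral mu (band P) (fun w => expi (w * (t / speed P))).

Lemma conj_dyadic_mul_data (x : R * R) (w : R) :
  conj_mx (dyadic_green (point3 x 0) y (wavenum P w)) *m data P yd pd x w =
  (perm P * w ^+ 2)%:C *:
    \sum_j (conj_mx (dyadic_green (point3 x 0) y (wavenum P w)) *m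
            dyadic_green (point3 x 0) (yd j) (wavenum P w)) *m pd j.
Proof.
rewrite -scalemxAr mulmx_sumr; congr (_ *: _).
by apply: eq_bigr => j _; rewrite mulmxA.
Qed.

Lemma cmeasurable_conj_dyadic_mul_data i :
  @cmeasurable R _ (measurableTypeR R * plane)%type setT (fun u =>
    (conj_mx (dyadic_green (point3 u.2 0) y (wavenum P u.1)) *m
     data P yd pd u.2 u.1) i 0).
Proof.
rewrite (_ : (fun _ => _) = fun u => (perm P * u.1 ^+ 2)%:C *
    \sum_j ((conj_mx (dyadic_green (point3 u.2 0) y (wavenum P u.1)) *m
            dyadic_green (point3 u.2 0) (yd j) (wavenum P u.1)) *m pd j) i 0);
  last by apply/funext => u; rewrite conj_dyadic_mul_data mxE summxE.
apply: cmeasurableM.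
  apply: cmeasurable_real; apply: measurable_funM => //.
  by apply: measurable_funX; exact: measurable_fst.
apply: cmeasurable_sum => j; apply: cmeasurable_mulmx => k l.
  exact: cmeasurable_dyadic_mulmx.
exact: cmeasurable_cst.
Qed.

(** The normalization cancels the factor of the data. The projection keeps only component i of each
    p_j, so range polarizations enter through the error alone. The error collects N dipoles times 3
    components. *)
Lemma dyadic_data_approx (x : R * R) (w : R) (i : 'I_2) :
  band P w -> array P x ->
  normc (((perm P * w ^+ 2)^-1)%:C *
    (conj_mx (dyadic_green (point3 x 0) y (wavenum P w)) *m data P yd pd x w)
      (lshift 1 i) 0 -
    (fresnel_const L)%:C * \sum_j pd j (lshift 1 i) 0 *
      expi (w * ((eta j - z) / speed P)))
  <= 3 * N%:R * (fresnel_const L * (C * e) * Kp).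
Proof.
move=> bw ax; have [_ w0] := band_sub bw.
have f0 : 0 <= fresnel_const L * (C * e).
  have H := band_dyadic_mulmx_approx 0 0 hz hz bw ax.
  exact: le_trans (normc_ge0 _) H.
rewrite conj_dyadic_mul_data mxE mulrA -rmorphM /= mulVf ?mul1r; last first.
  by rewrite gt_eqF// mulr_gt0// exprn_gt0.
rewrite summxE mulr_sumr -sumrB (le_trans (le_normc_sum _ _ _))//.
set K := fresnel_const L * (C * e) * Kp.
have -> : 3 * N%:R * K = \sum_(j < N) \sum_(l < 3) K.
  by rewrite !sumr_const !card_ord -mulrnA -[RHS]mulr_natr natrM; ring.
apply: ler_sum => j _.
set i3 := lshift 1 i; set ph := expi _.
have -> : (fresnel_const L)%:C * (pd j i3 0 * ph) =
    \sum_l (fresnel_const L)%:C * (ph * (cross_proj R i3 l)%:C) * pd j l 0.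
  rewrite (bigD1 i3)//= big1 ?addr0; last first.
    by move=> l li; rewrite /cross_proj eq_sym (negbTE li) !(mulr0, mul0r).
  by rewrite /cross_proj eqxx /= ltn_ord rmorph1 mulr1; ring.
rewrite mxE -sumrB (le_trans (le_normc_sum _ _ _))//.
apply: ler_sum => l _.
rewrite -mulrBl Normc.normcM ler_pM ?normc_ge0//.
  exact: band_dyadic_mulmx_approx.
exact: le_trans (normc_le_cnorm _ _) (hpd j).
Qed.

(** Integrating the previous estimate turns the exponentials into [band_phase], and 12 N is 4 times
    3 N. *)
Lemma imageKM_approx (i : 'I_2) :
  normc (imageKM P yd pd y i 0 -
         (a * fresnel_const L)%:C *
           \sum_j pd j (lshift 1 i) 0 * band_phase (eta j - z))
  <= beta * (12 * N%:R * C * Kp * e).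
Proof.
pose i3 := lshift 1 i : 'I_3.
pose F w (x : R * R) :=
  (conj_mx (dyadic_green (point3 x 0) y (wavenum P w)) *m
     data P yd pd x w) i3 0.
pose s w : R[i] := ((perm P * w ^+ 2)^-1)%:C.
pose h j w : R[i] := pd j i3 0 * expi (w * ((eta j - z) / speed P)).
pose g w : R[i] := (fresnel_const L)%:C * \sum_j h j w.
have -> : imageKM P yd pd y i 0 = cintegral mu (band P) (fun w =>
    s w * cintegral (mu \x mu)%E (array P) (F w)).
  rewrite !mxE; congr cintegral; apply/funext => w.
  by rewrite !mxE.
have mexp t : @cmeasurable R _ (measurableTypeR R) (band P)
    (fun w => expi (w * t)).
  by apply: cmeasurable_expi; exact: measurable_funM.
have mh j : @cmeasurable R _ (measurableTypeR R) (band P) (h j).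
  by apply: cmeasurableM => //; exact: cmeasurable_cst.
have hM j w : normc (h j w) <= Kp.
  rewrite Normc.normcM normc_expi mulr1.
  exact: le_trans (normc_le_cnorm _ _) (hpd j).
have sM w : normc (\sum_j h j w) <= \sum_(j < N) Kp.
  rewrite (le_trans (le_normc_sum _ _ _))//; apply: ler_sum => j _; exact: hM.
have ig : cintegral mu (band P) g = (fresnel_const L)%:C *
    \sum_j pd j i3 0 * band_phase (eta j - z).
  rewrite (cintegralZ (measurable_band P) band_lty _
    (cmeasurable_sum mh) (fun w _ => sM w)).
  congr (_ * _).
  rewrite (cintegral_sum (measurable_band P) band_lty mh (fun j w _ => hM j w)).
  apply: eq_bigr => j _.
  rewrite (cintegralZ (measurable_band P) band_lty _ (mexp _) (M := 1))//.
  by move=> w _; rewrite normc_expi.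
rewrite rmorphM -mulrA -ig.
have -> : beta * (12 * N%:R * C * Kp * e) =
    4 * (3 * N%:R * (fresnel_const L * (C * e) * Kp)) * a * bandw P.
  by rewrite /beta; ring.
apply: (@band_array_approx R P s g F
  (fresnel_const L * \sum_(j < N) Kp)) => //.
- exact: cmeasurable_conj_dyadic_mul_data.
- by apply/cmeasurable_real/measurable_funV; exact: measurable_funM.
- by apply: cmeasurableM; [exact: cmeasurable_cst|exact: cmeasurable_sum].
- move=> w /band_sub[_ w0].
  by rewrite /s fmorph_eq0 invr_eq0 gt_eqF// mulr_gt0// exprn_gt0.
- move=> w _; rewrite /g Normc.normcM normc_real.
  by rewrite gtr0_norm ?fresnel_const_gt0// ler_wpM2l// ltW// fresnel_const_gt0.
- by move=> w x; exact: dyadic_data_approx.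
Qed.

Lemma band_phase_le (t : R) : t != 0 ->
  normc (band_phase t) <= bandw P * (4 * (speed P / (bandw P * `|t|))).
Proof.
move=> t0; rewrite /band_phase band_itv.
have tc : t / speed P != 0 by rewrite mulf_neq0// invr_eq0 gt_eqF.
have lohi : freq0 P - bandw P / 2 < freq0 P + bandw P / 2 by have := B_gt0; lra.
rewrite (le_trans (cintegral_expi_le lohi tc))//.
rewrite normrM normfV (gtr0_norm speed_gt0).
rewrite le_eqVlt; apply/orP; left; apply/eqP; field.
by rewrite normr_eq0 t0 !gt_eqF.
Qed.

Lemma band_phase0 : band_phase 0 = (bandw P)%:C.
Proof.
rewrite /band_phase (_ : (fun _ => _) = fun=> 1); last first.
  by apply/funext => w; rewrite mul0r mulr0 expi0.
rewrite cintegral_cst ?mulr1//; last exact: measurable_band.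
by rewrite (congr1 fine (lebesgue_band B_gt0)).
Qed.

(** Here q is the expected limit: the polarization at a dipole, 0 elsewhere. Smallness of e makes
    the system matrix S invertible, and S (p - q) = I - S q, with I the image, splits into the image
    error, the mismatch X of the phase sum, and (S - beta) q. The outer 4 is the 2 of
    [near_scalar_bound] times two components. *)
Lemma polarization_solution (q : 'cV[R[i]]_2) (X : R) :
  4 * C * e <= 1 / 4 ->
  (forall i, normc (q i 0) <= Kp) ->
  (forall i : 'I_2, normc (\sum_j pd j (lshift 1 i) 0 * band_phase (eta j - z) -
                    (bandw P)%:C * q i 0) <= bandw P * X) ->
  exists p, unique (polarization_system P yd pd y) p /\
    cnorm (p - q) <= 4 * (X + 12 * N%:R * C * Kp * e + 8 * C * Kp * e).
Proof.
move=> e_small qK hX.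
have hS i j : normc (system_mx P y i j - beta%:C * (i == j)%:R) <= beta / 4.
  rewrite (le_trans (system_mx_approx i j hz))// ler_wpM2l ?(ltW beta_gt0)//.
  by lra.
have uS := near_scalar_unit beta_gt0 hS.
exists (invmx (system_mx P y) *m imageKM P yd pd y); split.
  split; first by rewrite /polarization_system mulKVmx.
  by move=> p <-; rewrite mulKmx.
set p := invmx _ *m _.
have bd := near_scalar_bound beta_gt0 hS (q := p - q)
  (t := X + 12 * N%:R * C * Kp * e + 8 * C * Kp * e).
apply: le_trans (cnorm_le_sum _) _.
apply: (@le_trans _ _ (\sum_(i < 2)
    2 * (X + 12 * N%:R * C * Kp * e + 8 * C * Kp * e))); last first.
  by rewrite sumr_const card_ord -mulr_natr; lra.
apply: ler_sum => i _; apply: bd => {}i.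
rewrite mulmxBr mulKVmx//.
set I := imageKM P yd pd y; set S := system_mx P y.
pose ph := \sum_j pd j (lshift 1 i) 0 * band_phase (eta j - z).
have -> : (I - S *m q) i 0 =
    (I i 0 - (a * fresnel_const L)%:C * ph) +
    (a * fresnel_const L)%:C * (ph - (bandw P)%:C * q i 0) -
    \sum_j (S i j - beta%:C * (i == j)%:R) * q j 0.
  have -> : \sum_j (S i j - beta%:C * (i == j)%:R) * q j 0 =
      (S *m q) i 0 - beta%:C * q i 0.
    rewrite mxE (eq_bigr (fun j => S i j * q j 0 -
        beta%:C * (i == j)%:R * q j 0)); last by move=> j _; rewrite mulrBl.
    rewrite sumrB; congr (_ - _).
    rewrite (bigD1 i)//= eqxx mulr1 big1 ?addr0// => j ji.
    by rewrite eq_sym (negbTE ji) mulr0 mul0r.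
  by rewrite /beta [(_ * bandw P)%:C]rmorphM !mxE; ring.
have -> : beta * (X + 12 * N%:R * C * Kp * e + 8 * C * Kp * e) =
  beta * (12 * N%:R * C * Kp * e) + beta * X + beta * (8 * C * Kp * e) by ring.
rewrite (le_trans (le_normcB _ _))// lerD//.
  rewrite (le_trans (le_normcD _ _))// lerD//; first exact: imageKM_approx.
  rewrite Normc.normcM normc_real ger0_norm; last first.
    by rewrite ltW// mulr_gt0// fresnel_const_gt0.
  rewrite /beta -mulrA ler_wpM2l//; last exact: hX.
  by rewrite ltW// mulr_gt0// fresnel_const_gt0.
rewrite (le_trans (le_normc_sum _ _ _))//.
apply: (@le_trans _ _ (\sum_(j < 2) beta * (4 * C * e) * Kp)).
  apply: ler_sum => j _; rewrite Normc.normcM ler_pM ?normc_ge0//.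
  exact: system_mx_approx.
by rewrite sumr_const card_ord -mulr_natr; lra.
Qed.

End Image.
End PolarizationSystem.

(** * Minima of lists and the resulting rates *)

Section SeqMin.
Variable R : realType.

Lemma seqmin_le (s : seq R) x : x \in s -> seqmin s <= x.
Proof. by move=> xs; rewrite /seqmin; exact: (ge_bigmin_seq _ x xpredT id). Qed.

Lemma seqmin_gt0 (s : seq R) : s != [::] -> {in s, forall x, 0 < x} ->
  0 < seqmin s.
Proof.
move=> s0 sgt0; rewrite /seqmin big_seq; elim/big_ind : _ => //.
(* For a nonempty list the initial value is its head, not the default 0. *)
- by case: s s0 sgt0 => // x s _; apply; rewrite inE eqxx.
- by move=> x y x0 y0; rewrite lt_min x0.
Qed.

Lemma le_rate (c b t : R) (s : seq R) : 0 < c -> 0 < b -> t \in s ->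
  {in s, forall x, 0 < x} -> c / (b * t) <= c / (b * seqmin s).
Proof.
move=> c0 b0 ts sgt0; rewrite ler_wpM2l ?(ltW c0)//.
have m0 : 0 < seqmin s by apply: seqmin_gt0 => //; case: s ts {sgt0}.
rewrite lef_pV2 ?posrE; [|by rewrite mulr_gt0// sgt0|by rewrite mulr_gt0].
by rewrite ler_wpM2l ?(ltW b0)// seqmin_le.
Qed.

End SeqMin.

(** * The error scale of the Fraunhofer regime *)

Section Regime.
Variables (R : realType) (F : set_system (params R)).
Hypotheses (FF : ProperFilter F) (HF : fraunhofer F).

Definition low_freq (P : params R) : R := freq0 P - bandw P / 2.

(** The wave number is taken at the lowest frequency of the band, where 1/(k L) is largest, so one
    number controls the whole band. *)
Definition fraunhofer_scale (P : params R) : R :=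
  (wavenum P (low_freq P) * dist P)^-1 +
  (arad P + bwin P + hwin P) / dist P.

Lemma closed_band_low_freq (P : params R) :
  admissible P -> closed_band P (low_freq P).
Proof.
move=> [_ [_ [b0 _]]]; rewrite /closed_band /low_freq /= lexx /=; lra.
Qed.

Lemma fraunhofer_scale_small (d : R) : 0 < d ->
  \forall P \near F, `|fraunhofer_scale P| <= d.
Proof.
move=> d0; have d4 : 0 < d / 4 by rewrite divr_gt0.
have hL := fr_kL HF d4; have ha := fr_a HF d4.
have hb := fr_b HF d4; have hh := fr_h HF d4.
have hadm := fr_admissible HF.
near=> P.
have cw : closed_band P (low_freq P).
  by apply: closed_band_low_freq; near: P.
(* Generalizing over the frequency recovers the uniform statement that holds eventually along
   [F]. *)
have iL : `|1 / (wavenum P (low_freq P) * dist P)| <= d / 4.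
  by move: cw; move: (low_freq P); near: P.
have ia : `|arad P / dist P| <= d / 4.
  by move: cw; move: (low_freq P); near: P.
have ib : `|bwin P / dist P| <= d / 4.
  by move: cw; move: (low_freq P); near: P.
have ih : `|hwin P / dist P| <= d / 4.
  by move: cw; move: (low_freq P); near: P.
rewrite /fraunhofer_scale !mulrDl (le_trans (ler_normD _ _))//.
rewrite -[X in `|X| + _]div1r.
have := ler_normD (arad P / dist P + bwin P / dist P) (hwin P / dist P).
have := ler_normD (arad P / dist P) (bwin P / dist P).
lra.
Unshelve. all: by end_near. Qed.

Lemma fraunhofer_scale_cvg (c : R) :
  (fun P => c * fraunhofer_scale P) @ F --> (0 : R).
Proof.
apply/cvgrPdist_le => d d0; rewrite /=.
have c0 : 0 < d / (`|c| + 1) by rewrite divr_gt0// ltr_wpDl.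
apply: filterS (fraunhofer_scale_small c0) => P.
rewrite ler_pdivlMr ?ltr_wpDl// => h.
rewrite sub0r normrN normrM; have := normr_ge0 (fraunhofer_scale P); nra.
Qed.

End Regime.

(** The size of K lets a single e dominate 1/(k L), (a + |Kb| b)/L and |Kh| h/L at once. Absolute
    values are taken because the signs of Kb and Kh are arbitrary. *)
Lemma fraunhofer_bounds (R : realType) (P : params R) (Kb Kh M K : R) :
  admissible P -> 1 + `|Kb| + `|Kh| <= K ->
  (forall w, closed_band P w -> `|wavenum P w * hwin P| <= M) ->
  let e := K * fraunhofer_scale P in
  [/\ 0 < e,
      arad P + `|Kb| * bwin P <= e * dist P,
      `|Kh| * hwin P <= e * dist P,
      forall w, closed_band P w -> 1 <= e * (wavenum P w * dist P)
    & forall w, closed_band P w ->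
        2 * (wavenum P w * (`|Kh| * hwin P)) <= 2 * `|Kh| * M].
Proof.
move=> adm hK hM e.
have [[c0 _ a0] [[b0 h0 L0] [B0 f0]]] := adm.
have k0 : 0 < wavenum P (low_freq P) by rewrite divr_gt0.
have kL0 : 0 < wavenum P (low_freq P) * dist P by rewrite mulr_gt0.
have Kb0 := normr_ge0 Kb; have Kh0 := normr_ge0 Kh.
have K1 : 1 <= K by lra.
have i0 : 0 < (wavenum P (low_freq P) * dist P)^-1 by rewrite invr_gt0.
have s0 : 0 < (arad P + bwin P + hwin P) / dist P.
  by rewrite divr_gt0// !addr_gt0.
have eL : K * (arad P + bwin P + hwin P) <= e * dist P.
  rewrite /e /fraunhofer_scale -mulrA ler_wpM2l//; first by lra.
  by rewrite mulrDl divfK ?gt_eqF// lerDr mulr_ge0// ltW.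
split.
- by rewrite mulr_gt0// ?addr_gt0//; lra.
- by apply: le_trans eL; nra.
- by apply: le_trans eL; nra.
- move=> w /andP[w1 _].
  have kw : wavenum P (low_freq P) <= wavenum P w.
    by rewrite /wavenum ler_wpM2r// invr_ge0 ltW.
  have e1 : (wavenum P (low_freq P) * dist P)^-1 <= e.
    by rewrite /e /fraunhofer_scale; nra.
  have kwL : wavenum P (low_freq P) * dist P <= wavenum P w * dist P.
    by rewrite ler_wpM2r// ltW.
  rewrite -[leLHS](mulVf (lt0r_neq0 kL0)).
  by apply: ler_pM => //; exact: ltW.
- move=> w /hM h; rewrite -[leRHS]mulrA ler_wpM2l//.
  by rewrite mulrCA ler_wpM2l// (le_trans (ler_norm _)).
Qed.

(** * Uniform solution estimate in the regime and the two claims *)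

Lemma error_const_gt0 (R : realType) (t : R) : 0 <= t -> 0 < 684 + 192 * t.
Proof. by move=> t0; lra. Qed.

Lemma error_const_ge (R : realType) (t : R) : 0 <= t -> 684 <= 684 + 192 * t.
Proof. by move=> t0; lra. Qed.

(** The threshold on the scale means 16 C e <= 1 for e = K times the scale. This gives 4 C e <= 1/4
    and, as C >= 684, also e <= 1/8. *)
Lemma polarization_solution_fraunhofer (R : realType) (P : params R) (N : nat)
    (Kb Kh Kp M : R) (ys : R * R) (eta : 'I_N -> R) (pd : 'I_N -> 'cV[R[i]]_3)
    (z : R) (q : 'cV[R[i]]_2) (X : R) :
  let C := 684 + 192 * (2 * `|Kh| * M) in
  let K := 1 + `|Kb| + `|Kh| in
  admissible P -> 0 <= M ->
  (forall w, closed_band P w -> `|wavenum P w * hwin P| <= M) ->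
  `|fraunhofer_scale P| <= (16 * C * K)^-1 ->
  aligned_dipoles Kb Kh Kp P ys eta pd -> `|z| <= Kh * hwin P ->
  (forall i, normc (q i 0) <= `|Kp|) ->
  (forall i : 'I_2, normc (\sum_j pd j (lshift 1 i) 0 *
     band_phase P (eta j - z) - (bandw P)%:C * q i 0) <= bandw P * X) ->
  exists p,
    unique (polarization_system P (fun j => point3 ys (dist P + eta j)) pd
      (point3 ys (dist P + z))) p /\
    cnorm (p - q) <=
      4 * X + 4 * ((12 * N%:R + 8) * C * `|Kp|) * K * fraunhofer_scale P.
Proof.
have lin8 (c t : R) : 16 * t <= 1 -> 684 * c <= t -> c <= 1 / 8.
  by move=> h1 h2; lra.
have lin4 (t : R) : 16 * t <= 1 -> 4 * t <= 1 / 4 by move=> h; lra.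
move=> C K adm M0 kM sm [hys heta _ hpd] hz hq hX.
have Kb0 := normr_ge0 Kb; have Kh0 := normr_ge0 Kh.
have Q0 : 0 <= 2 * `|Kh| * M by rewrite mulr_ge0// mulr_ge0.
have C0 : 0 < C := error_const_gt0 Q0.
have K0 : 0 < K by rewrite /K ltr_wpDr// ltr_wpDr.
have [e0 h1 h2 h3 h4] := fraunhofer_bounds adm (lexx K) kM.
set e := K * fraunhofer_scale P in e0 h1 h2 h3.
have CK0 : 0 < 16 * C * K by rewrite !mulr_gt0.
have eC : 16 * (C * e) <= 1.
  have := ler_wpM2r (ltW CK0) (le_trans (ler_norm _) sm).
  rewrite mulVf ?gt_eqF//; apply: le_trans.
  by rewrite /e le_eqVlt; apply/orP; left; apply/eqP; ring.
have e8 : 0 < e <= 1 / 8.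
  apply/andP; split=> //.
  exact: lin8 eC (ler_wpM2r (ltW e0) (error_const_ge Q0)).
have [_ [[b0 h0 _] _]] := adm.
have hys' : norm2 ys <= `|Kb| * bwin P.
  by rewrite (le_trans hys)// ler_wpM2r ?(ltW b0)// ler_norm.
have hz' (t : R) : `|t| <= Kh * hwin P -> `|t| <= `|Kh| * hwin P.
  by move=> ht; rewrite (le_trans ht)// ler_wpM2r ?(ltW h0)// ler_norm.
have hpd' j : cnorm (pd j) <= `|Kp| by rewrite (le_trans (hpd j))// ler_norm.
have eC4 : 4 * C * e <= 1 / 4.
  by rewrite -mulrA; exact: lin4.
have [p [up hp]] := polarization_solution adm e8 h1 h2 h3 h4 hys'
  (fun j => hz' _ (heta j)) hpd' (hz' _ hz) eC4 hq hX.
exists p; split => //; apply: le_trans hp _.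
by rewrite le_eqVlt; apply/orP; left; apply/eqP; rewrite /e /C; ring.
Qed.

(** Each summand is at most |Kp| times 4 c / |eta j - z|, largest at the minimal distance. The set J
    is all dipoles but one in (i), all dipoles in (ii). *)
Lemma phase_sum_le (R : realType) (P : params R) (N : nat) (Kp : R) (s : seq R)
    (J : pred 'I_N) (eta : 'I_N -> R) (pd : 'I_N -> 'cV[R[i]]_3) (z : R) l :
  admissible P -> (forall j, cnorm (pd j) <= Kp) ->
  {in s, forall x, 0 < x} -> (forall j, J j -> `|eta j - z| \in s) ->
  s != [::] ->
  normc (\sum_(j | J j) pd j l 0 * band_phase P (eta j - z)) <=
  bandw P * (4 * N%:R * `|Kp| * (speed P / (bandw P * seqmin s))).
Proof.
move=> adm hpd sgt0 hJ sn0.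
have [[c0 _ _] [_ [B0 _]]] := adm.
rewrite (le_trans (le_normc_sum _ _ _))//.
set r := speed P / _.
have r0 : 0 <= r.
  by rewrite divr_ge0 ?(ltW c0)// mulr_ge0 ?(ltW B0)// ltW// seqmin_gt0.
have t0 : 0 <= `|Kp| * (bandw P * (4 * r)).
  by rewrite mulr_ge0// mulr_ge0 ?(ltW B0)// mulr_ge0.
apply: (@le_trans _ _ (\sum_(j | J j) `|Kp| * (bandw P * (4 * r)))).
  apply: ler_sum => j Jj; rewrite Normc.normcM ler_pM ?normc_ge0//.
    by rewrite (le_trans (normc_le_cnorm _ _))// (le_trans (hpd j))// ler_norm.
  have js := hJ j Jj; have /sgt0 := js; rewrite normr_gt0 => nz.
  rewrite (le_trans (band_phase_le adm nz))// ler_wpM2l ?(ltW B0)// ler_wpM2l//.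
  exact: le_rate.
apply: (@le_trans _ _ (\sum_(j < N) `|Kp| * (bandw P * (4 * r)))).
  by rewrite [leRHS](bigID J)/= lerDl sumr_ge0.
rewrite sumr_const card_ord -mulr_natr le_eqVlt; apply/orP; left.
by apply/eqP; ring.
Qed.

Theorem proposition2p5 (R : realType) (N : nat) (N_gt0 : (0 < N)%N)
    (F : set_system (params R)) (FF : ProperFilter F) (HF : fraunhofer F)
    (Kb Kh Kp : R) :
  (exists (C : R) (eps : params R -> R),
     eps @ F --> (0 : R) /\
     \forall P \near F,
       forall (ys : R * R) (eta : 'I_N -> R) (pd : 'I_N -> 'cV[R[i]]_3),
       aligned_dipoles Kb Kh Kp P ys eta pd ->
       let yd := fun j => point3 ys (dist P + eta j) in
       forall i : 'I_N,
       exists p : 'cV[R[i]]_2,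
         unique (polarization_system P yd pd (yd i)) p /\
         cnorm (p - cross_range (pd i)) <=
           C * rate_at_dipole P eta i + eps P)
  /\
  (exists (C : R) (eps : params R -> R),
     eps @ F --> (0 : R) /\
     \forall P \near F,
       forall (ys : R * R) (eta : 'I_N -> R) (pd : 'I_N -> 'cV[R[i]]_3),
       aligned_dipoles Kb Kh Kp P ys eta pd ->
       let yd := fun j => point3 ys (dist P + eta j) in
       forall z : R, `|z| <= Kh * hwin P ->
       let y := point3 ys (dist P + z) in
       (forall j, y <> yd j) ->
       exists p : 'cV[R[i]]_2,
         unique (polarization_system P yd pd y) p /\
         cnorm p <= C * rate_off_dipoles P eta z + eps P).
Proof.
have [M0 hM0] := fr_kh HF.
pose M := `|M0|; pose C := 684 + 192 * (2 * `|Kh| * M).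
pose K := 1 + `|Kb| + `|Kh|.
have M_ge0 : 0 <= M := normr_ge0 M0.
have Q0 : 0 <= 2 * `|Kh| * M by rewrite mulr_ge0// mulr_ge0.
pose eps P := 4 * ((12 * N%:R + 8) * C * `|Kp|) * K * fraunhofer_scale P.
have heps : eps @ F --> (0 : R) by exact: fraunhofer_scale_cvg.
have regime : \forall P \near F, [/\ admissible P,
    (forall w, closed_band P w -> `|wavenum P w * hwin P| <= M) &
    `|fraunhofer_scale P| <= (16 * C * K)^-1].
  have hsmall : \forall P \near F, `|fraunhofer_scale P| <= (16 * C * K)^-1.
    apply: fraunhofer_scale_small => //.
    rewrite invr_gt0 mulr_gt0//; last by rewrite /K ltr_wpDr// ltr_wpDr.
    by rewrite mulr_gt0// error_const_gt0.
  apply: filterS3 (fr_admissible HF) hM0 hsmall => P adm kM sm; split => // w /kM.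
  by move/le_trans; apply; exact: ler_norm.
split.
(* The outer 4 comes from [polarization_solution], the factor 4 N |Kp| from [phase_sum_le]. *)
- exists (4 * (4 * N%:R * `|Kp|)), eps; split => //.
  apply: filterS regime => P [adm kM sm] ys eta pd al i.
  have [_ heta ieta hpd] := al.
  have phase0 := band_phase0 adm.
  have hq (l : 'I_2) : normc (cross_range (pd i) l 0) <= `|Kp|.
    rewrite mxE (le_trans (normc_le_cnorm _ _))// (le_trans (hpd i))//.
    exact: ler_norm.
  have hX (l : 'I_2) : normc (\sum_j pd j (lshift 1 l) 0 *
      band_phase P (eta j - eta i) - (bandw P)%:C * cross_range (pd i) l 0) <=
      bandw P * (4 * N%:R * `|Kp| * rate_at_dipole P eta i).
    (* The term j = i has phi(0) = B and cancels B p_i exactly; only the other dipoles remain. *)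
    rewrite (bigD1 i)//= subrr phase0 [cross_range _ _ _]mxE mulrC.
    rewrite addrAC subrr add0r.
    (* For N = 1 the remaining sum is empty, in accordance with the rate 0. *)
    rewrite /rate_at_dipole; case: eqP => [N1|/eqP N1].
      have ord_eq0 (k : 'I_N) : k = 0%N :> nat.
        by have := ltn_ord k; rewrite [X in (_ < X)%N]N1 ltnS leqn0 => /eqP.
      rewrite big1 ?Normc.normc0 ?mulr0// => j /eqP[]; apply/val_inj => /=.
      by rewrite !ord_eq0.
    apply: phase_sum_le => //.
    + move=> x /mapP[j]; rewrite mem_filter => /andP[ji _] ->.
      by rewrite normr_gt0 subr_eq0 eq_sym (inj_eq ieta).
    + move=> j ji; apply/mapP; exists j; last by rewrite distrC.
      by rewrite mem_filter ji mem_enum.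
    (* With N > 1 there is an index other than i, so the minimum is over a nonempty list. *)
    + rewrite -size_eq0 size_map size_filter -lt0n -has_count.
      have : #|predC1 i| != 0%N.
        by rewrite cardC1 card_ord; move: N1 N_gt0; case: (N) => [|[]].
      rewrite -lt0n => /card_gt0P[j ji]; apply/hasP; exists j => //.
      by rewrite mem_enum.
  have [p [up hp]] := polarization_solution_fraunhofer adm (normr_ge0 M0) kM sm
    al (heta i) hq hX.
  exists p; split => //.
  by move: hp; rewrite [4 * (_ * rate_at_dipole _ _ _)]mulrA.
- exists (4 * (4 * N%:R * `|Kp|)), eps; split => //.
  apply: filterS regime => P [adm kM sm] ys eta pd al z hz hy.
  have [_ _ _ hpd] := al.
  (* Away from the dipoles the reference vector is 0, and the whole phase sum is error. *)
  have hq (l : 'I_2) : normc ((0 : 'cV[R[i]]_2) l 0) <= `|Kp|.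
    by rewrite mxE Normc.normc0.
  have hX (l : 'I_2) : normc (\sum_j pd j (lshift 1 l) 0 *
      band_phase P (eta j - z) - (bandw P)%:C * (0 : 'cV[R[i]]_2) l 0) <=
      bandw P * (4 * N%:R * `|Kp| * rate_off_dipoles P eta z).
    rewrite mxE mulr0 subr0; apply: phase_sum_le => //.
    + move=> x /mapP[j _] ->; rewrite normr_gt0 subr_eq0; apply/eqP => zj.
      by apply: (hy j); rewrite zj.
    + by move=> j _; apply/mapP; exists j; rewrite ?mem_enum// distrC.
    + by rewrite -size_eq0 size_map size_enum_ord -lt0n.
  have [p [up hp]] := polarization_solution_fraunhofer adm (normr_ge0 M0) kM sm
    al hz hq hX.
  exists p; split => //.
  by move: hp; rewrite subr0 [4 * (_ * rate_off_dipoles _ _ _)]mulrA.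
Qed.
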